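(* Let $F\in\mathcal{S}_n(\mathbb{T})\cap L_\infty(\mathbb{T})^{n\times n}$ with $\ell_F\in L_\infty(\mathbb{T})$, and let $G\in\mathcal{S}_n(\mathbb{T})$. Then $$\|G^+-F^+\|_{H_2}^2\le\|F\|_{L_\infty}\left(n\,e^{\|\ell_F\|_{L_\infty}}\|G-F\|_{L_1}+\left\|\log\frac{\det G}{\det F}\right\|_{L_1}\right).$$
   Context: $\mathbb{D}=\{|z|<1\}$, $\mathbb{T}=\{|z|=1\}$ with normalized Lebesgue measure $m$, and $n\ge1$. For a matrix $M\in\mathbb{C}^{n\times n}$, $\|M\|$ is the operator norm induced by the Euclidean norm. For measurable $F:\mathbb{T}\to\mathbb{C}^{n\times n}$, $\|F\|_{L_p}=\left(\frac1{2\pi}\int_0^{2\pi}\|F(e^{i\theta})\|^p\,d\theta\right)^{1/p}$, $p\ge1$, and $\|F\|_{L_\infty}=\operatorname{ess\,sup}\|F(e^{i\theta})\|$; $L_p(\mathbb{T})^{n\times n}$ is the class of matrix functions with finite $L_p$ norm (scalar functions: $n=1$). $H_2^{n\times n}=H_2(\mathbb{D})^{n\times n}$, the analytic matrix functions with entries in the Hardy space $H_2$, is identified through boundary values with a subspace of $L_2(\mathbb{T})^{n\times n}$, and $\|\cdot\|_{H_2}$ is the $L_2$ norm above of the boundary function. $\mathcal{S}_n(\mathbb{T})$ is the set of $F\in L_1(\mathbb{T})^{n\times n}$ that are positive definite a.e. on $\mathbb{T}$ and satisfy $\log\det F\in L_1(\mathbb{T})$. A matrix function in $H_2^{n\times n}$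 is outer if its determinant is a scalar outer function in $H_{2/n}$, i.e. of the form $c\exp\left(\frac1{2\pi}\int_0^{2\pi}\frac{e^{i\theta}+z}{e^{i\theta}-z}\log|f(e^{i\theta})|\,d\theta\right)$, $|c|=1$. For $F\in\mathcal{S}_n(\mathbb{T})$, the spectral factor $F^+$ is the unique outer $F^+\in H_2^{n\times n}$ with $F=F^+(F^+)^*$ a.e. on $\mathbb{T}$ and $F^+(0)$ positive definite (existence and uniqueness are classical). $\log_+x=\max(0,\log x)$, and $\ell_F:=\log\det F-n\log_+\|F\|\in L_1(\mathbb{T})$. *)

(* Defs.v *)
From HB Require Import structures.
From mathcomp Require Import all_boot all_order all_algebra.
From mathcomp Require Import complex.
From mathcomp Require Import all_classical all_reals all_analysis.

Set Implicit Arguments.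
Unset Strict Implicit.
Unset Printing Implicit Defensive.

Import Order.TTheory GRing.Theory Num.Theory.
Import numFieldNormedType.Exports.

Local Open Scope classical_set_scope.
Local Open Scope ring_scope.
Local Open Scope complex_scope.
Local Open Scope sesquilinear_scope.

Section Matrices.
Variables (R : realType) (n : nat).

Definition cvnorm (x : 'cV[R[i]]_n) : R :=
  Num.sqrt (\sum_(i < n) Normc.normc (x i 0) ^+ 2).

Definition opnorm (M : 'M[R[i]]_n) : R :=
  sup [set cvnorm (M *m x) | x in [set x : 'cV[R[i]]_n | cvnorm x <= 1]].

(* On R[i], 0 < z means that z is real and positive. *)
Definition posdefmx (M : 'M[R[i]]_n) : Prop :=
  M \is hermsymmx /\
  forall x : 'cV[R[i]]_n, x != 0 -> 0 < (x ^t* *m M *m x) 0 0.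

(* The real part is only taken to land in R. *)
Definition logdet (M : 'M[R[i]]_n) : R := ln (complex.Re (\det M)).

Definition logplus (x : R) : R := Num.max 0 (ln x).

End Matrices.

(* A function on T (or on the closed disc) is a function on R[i] of which only *)
(* the values on T (or on the closed disc) are ever used; integration over T   *)
(* is carried out in the variable theta of e^{i theta}. Measurability is with  *)
(* respect to the Borel sets: every class modulo null sets has a Borel         *)
(* representative, and all the notions below depend on these classes only.     *)
Section Circle.
Variable R : realType.

Definition cis (t : R) : R[i] := cos t +i* sin t.

Definition cexp (z : R[i]) : R[i] :=
  (expR (complex.Re z))%:C * cis (complex.Im z).

Lemma inv_2pi_ge0 : 0 <= (2 * pi : R)^-1.
Proof. by rewrite invr_ge0 mulr_ge0// pi_ge0. Qed.

Definition circle_measure : {measure set (measurableTypeR R) -> \bar R} :=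
  mscale (NngNum inv_2pi_ge0)
    (mrestr lebesgue_measure (measurable_itv `[0, 2 * pi])).

Definition cintegral (g : R -> R[i]) : R[i] :=
  (\int[circle_measure]_t complex.Re (g t)) +i*
  (\int[circle_measure]_t complex.Im (g t)).

Definition measurable_circle (f : R[i] -> R[i]) : Prop :=
  measurable_fun setT (fun t : R => complex.Re (f (cis t))) /\
  measurable_fun setT (fun t : R => complex.Im (f (cis t))).

End Circle.

Section Lebesgue.
Variables (R : realType) (n : nat).
Local Notation m := (@circle_measure R).
Implicit Types (p : \bar R) (f : R[i] -> R) (F : R[i] -> 'M[R[i]]_n).

Definition Lnorm_fun p f : \bar R :=
  Lnorm m p (EFin \o (fun t : R => f (cis t))).

Definition Lnorm_mx p F : \bar R := Lnorm_fun p (fun z => opnorm (F z)).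

Definition in_L p f : Prop := (fun t : R => f (cis t)) \in Lfun m p.

Definition in_Lmx p F : Prop :=
  (forall i j, measurable_circle (fun z => F z i j)) /\
  (Lnorm_mx p F < +oo)%E.

Definition spectral_density F : Prop :=
  [/\ in_Lmx 1%E F,
      {ae m, forall t, posdefmx (F (cis t))} &
      in_L 1%E (fun z => logdet (F z))].

Definition ell F : R[i] -> R :=
  fun z => logdet (F z) - n%:R * logplus (opnorm (F z)).

End Lebesgue.

Section Hardy.
Variable R : realType.
Local Notation m := (@circle_measure R).

(* Complex differentiability: the increments range over R[i]. *)
Definition analytic_disc (f : R[i] -> R[i]) : Prop :=
  forall z : R[i], `|z| < 1 -> derivable (f : R[i]^o -> R[i]^o) z 1.

(* f carries both the analytic function (its values on D) and the boundary     *)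
(* function (its values on T, a.e. equal to the radial limits).                *)
Definition hardy (p : R) (f : R[i] -> R[i]) : Prop :=
  [/\ analytic_disc f,
      exists K : R, forall r : R, 0 <= r < 1 ->
        (\int[m]_t (Normc.normc (f (r%:C * cis t)) `^ p)%:E <= K%:E)%E,
      measurable_circle f &
      {ae m, forall t : R,
        (fun r : R => f (r%:C * cis t) : R[i]^o) @ 1^'- -->
          (f (cis t) : R[i]^o)}].

(* ln 0 = 0 in the library, hence the condition that f be nonzero a.e.         *)
Definition outer (p : R) (f : R[i] -> R[i]) : Prop :=
  [/\ hardy p f,
      {ae m, forall t : R, f (cis t) != 0},
      in_L 1%E (fun z => ln (Normc.normc (f z))) &
      exists2 c : R[i], Normc.normc c = 1 &
        forall z : R[i], `|z| < 1 ->
          f z = c * cexp (cintegral (fun t : R =>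
            (cis t + z) / (cis t - z) *
            (ln (Normc.normc (f (cis t))))%:C))].

Definition outer_mx (n : nat) (F : R[i] -> 'M[R[i]]_n) : Prop :=
  (forall i j, hardy 2 (fun z => F z i j)) /\
  outer (2 / n%:R) (fun z => \det (F z)).

Definition spectral_factor (n : nat) (F Fp : R[i] -> 'M[R[i]]_n) : Prop :=
  [/\ outer_mx Fp,
      {ae m, forall t : R, F (cis t) = Fp (cis t) *m (Fp (cis t)) ^t*} &
      posdefmx (Fp 0)].

Definition H2norm (n : nat) (F : R[i] -> 'M[R[i]]_n) : \bar R :=
  Lnorm_mx 2%:E F.

End Hardy.

(* Main.v *)
Require Import Defs.
From mathcomp Require Import all_boot all_order all_algebra.
From mathcomp Require Import perm.
From mathcomp Require Import complex.
From mathcomp Require Import all_classical all_reals all_analysis.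
From mathcomp Require Import measurable_realfun ess_sup_inf.
From mathcomp Require Import ring lra.

Set Implicit Arguments.
Unset Strict Implicit.
Unset Printing Implicit Defensive.

Import Order.TTheory GRing.Theory Num.Theory.
Import numFieldNormedType.Exports.

Local Open Scope classical_set_scope.
Local Open Scope ring_scope.
Local Open Scope complex_scope.
Local Open Scope sesquilinear_scope.

(** Let X = F_+^{-1} G_+. On the circle, G_+ - F_+ = F_+ (X - 1), hence
    [|G_+ - F_+|^2 <= |F| |X - 1|_HS^2 = |F| (|X|_HS^2 - n + 2 n - 2 Re tr X)],
    and two quantities have to be estimated.

    First, X X^* - 1 = F_+^{-1} (G - F) F_+^{-*}, so |X|_HS^2 - n is at most |G - F|
    times the trace of F^{-1}; since each eigenvalue of F is at least
    det F / max(1, |F|)^(n-1), this trace is at most n exp(- ell_F) (lemmas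
    frob2_quotient_le and frob2_inv_factor).

    Second, the mean of Re tr X over the circle is bounded from below. The
    function tr X = tr (adj(F_+) G_+) / det F_+ is analytic on the disc. As F is
    bounded, so is F_+, by the Poisson formula; as ell_F is bounded, det F is
    bounded away from 0 on the circle, and therefore det F_+, being outer, is
    bounded away from 0 on the disc (outer_lower). Hence the squares of tr X have
    bounded means over the circles of radius r < 1, like those of the entries of
    G_+, and tr X has the mean value property up to the boundary: the mean over
    the unit circle is tr X(0) (radial_mean). Now F_+(0) and G_+(0) are positive
    definite, and ln x <= x - 1 applied to the eigenvalues of X(0) yields
    [Re tr X(0) >= n + ln det G_+(0) - ln det F_+(0)]   (trace_ge_logdet);
    as the determinants are outer, the difference of logarithms is half the mean
    of log (det G / det F). Therefore the mean of 2 n - 2 Re tr X is at most the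
    L_1 norm of log (det G / det F) (trace_quot_mean), and integrating the
    pointwise inequality ends the proof.

    The mean value property for functions that are merely complex differentiable
    rests on Goursat's theorem, proved by bisection for the contraction of the
    circle to a point (goursat_rect, circle_deformation), and leads to the Cauchy
    and Poisson formulas. An L2 bound lets these pass to the boundary, by uniform
    integrability (vitali_L2, radial_poisson). *)

(** * Rectangles and closed forms *)

Section Bisection.
Variable R : realType.

(** Nested quarters of a rectangle shrink to a point: the two booleans say which
    half is kept in each coordinate, and both sides are halved at every step, so
    that the shape of the rectangle is preserved. *)
Lemma bisection2 (a b H K : R) (B : nat -> R -> R -> Prop) :
  0 <= H -> 0 <= K -> B 0%N a b ->
  (forall k x y, B k x y -> exists s t : bool,
     B k.+1 (x + s%:R * (H / 2 ^+ k.+1)) (y + t%:R * (K / 2 ^+ k.+1))) ->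
  exists p q, forall k, exists x y,
    [/\ B k x y, x <= p <= x + H / 2 ^+ k & y <= q <= y + K / 2 ^+ k].
Proof.
move=> H0 K0 B0 Bs.
have Bs' k (z : {xy : R * R | B k xy.1 xy.2}) :
  { z' : {xy : R * R | B k.+1 xy.1 xy.2} | exists s t : bool,
    sval z' = ((sval z).1 + s%:R * (H / 2 ^+ k.+1),
               (sval z).2 + t%:R * (K / 2 ^+ k.+1)) }.
  apply: cid; case: z => -[x y] /= Bk.
  have [s [t Bst]] := Bs _ _ _ Bk.
  by exists (exist _ (_, _) Bst) => /=; exists s, t.
pose z := fix z k : {xy : R * R | B k xy.1 xy.2} :=
  if k is k'.+1 then sval (Bs' k' (z k')) else exist _ (a, b) B0.
have zS k : exists s t : bool, sval (z k.+1) = 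
    ((sval (z k)).1 + s%:R * (H / 2 ^+ k.+1),
     (sval (z k)).2 + t%:R * (K / 2 ^+ k.+1)).
  by rewrite /=; case: (Bs' _ _).
have nest (u : nat -> R) (L : R) : 0 <= L ->
    (forall k, exists s : bool, u k.+1 = u k + s%:R * (L / 2 ^+ k.+1)) ->
    exists p, forall k, u k <= p <= u k + L / 2 ^+ k.
  move=> L0 uS.
  have up k : u k <= u k.+1.
    have [s ->] := uS k; rewrite lerDl mulr_ge0// divr_ge0// exprn_ge0//.
  have dn k : u k.+1 + L / 2 ^+ k.+1 <= u k + L / 2 ^+ k.
    have [s ->] := uS k.
    have -> : L / 2 ^+ k = L / 2 ^+ k.+1 + L / 2 ^+ k.+1.
      by rewrite exprS invfM; field; rewrite expf_neq0.
    have : 0 <= L / 2 ^+ k.+1 by rewrite divr_ge0// exprn_ge0.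
    case: s => /=; lra.
  have ups k j : (k <= j)%N -> u k <= u j.
    move: k j; apply: (@homo_leq _ u (fun x y => x <= y)); [exact: lexx| |exact: up].
    by move=> y x w; exact: le_trans.
  have dns k j : (k <= j)%N -> u j + L / 2 ^+ j <= u k + L / 2 ^+ k.
    move: k j; apply: (@homo_leq _ (fun k => u k + L / 2 ^+ k)
      (fun x y => y <= x)); [exact: lexx| |exact: dn].
    by move=> y x w xy wy; exact: le_trans wy xy.
  have ub k j : u j <= u k + L / 2 ^+ k.
    have Lk i : 0 <= L / 2 ^+ i by rewrite divr_ge0// exprn_ge0.
    have [kj|/ltnW jk] := leqP k j.
      by apply: le_trans (dns _ _ kj); rewrite lerDl.
    by apply: le_trans (ups _ _ jk) _; rewrite lerDl.
  exists (sup (range u)) => k; apply/andP; split.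
    apply: ub_le_sup; last by exists k.
    by exists (u 0%N + L / 2 ^+ 0) => _ [j _ <-].
  by apply: ge_sup; [exists (u 0%N), 0%N|move=> _ [j _ <-]].
have [p pP] := nest (fun k => (sval (z k)).1) H H0
  ltac:(move=> k; have [s [t ->]] := zS k; exists s; done).
have [q qP] := nest (fun k => (sval (z k)).2) K K0
  ltac:(move=> k; have [s [t ->]] := zS k; exists t; done).
exists p, q => k; exists (sval (z k)).1, (sval (z k)).2; split => //.
exact: (svalP (z k)).
Qed.

End Bisection.

Section Goursat.
Variable R : realType.
Local Notation mu := (@lebesgue_measure R).
Local Notation "'int' ( a , b ) g" := (\int[mu]_(x in `[a, b]%classic) g x)
  (at level 10, g at level 8).

Lemma int_split (a c b : R) (g : R -> R) : a <= c -> c <= b ->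
  mu.-integrable `[a, b] (EFin \o g) ->
  int(a, b) g = int(a, c) g + int(c, b) g.
Proof.
move=> ac cb ig.
have : int(a, b) g - int(a, c) g = \int[mu]_(x in `]c, b]) g x.
  by apply: Rintegral_itvB; rewrite // bnd_simp.
rewrite Rintegral_itv_obnd_cbnd => [<-|]; first by rewrite addrC subrK.
apply: integrableS ig => // x /=; rewrite !in_itv/= => /andP[cx ->].
by rewrite (le_trans ac (ltW cx)).
Qed.

Lemma int_le_cst (a b e c : R) (g : R -> R) : a <= b ->
  mu.-integrable `[a, b] (EFin \o g) ->
  (forall x, a <= x <= b -> `|g x - c| <= e) ->
  `|int(a, b) g - c * (b - a)| <= e * (b - a).
Proof.
move=> ab ig gc.
have m r : int(a, b) (fun=> r) = r * (b - a).
  rewrite Rintegral_cst//= lebesgue_measure_itv/= lte_fin.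
  move: ab; rewrite le_eqVlt => /predU1P[->|ab]; first by rewrite ltxx subrr.
  by rewrite ab.
have ic r : mu.-integrable `[a, b] (EFin \o (fun=> r : R)).
  apply: continuous_compact_integrable; first exact: segment_compact.
  by apply: continuous_subspaceT => x; exact: cvg_cst.
rewrite ler_norml; apply/andP; split.
  rewrite lerBrDl -mulNr -mulrDl -m; apply: le_Rintegral => // x.
  by rewrite /= in_itv/= => /gc; rewrite ler_norml; lra.
rewrite lerBlDl -mulrDl -m; apply: le_Rintegral => // x.
by rewrite /= in_itv/= => /gc; rewrite ler_norml; lra.
Qed.

Lemma int_sub (a b : R) (f g : R -> R) :
  mu.-integrable `[a, b] (EFin \o f) -> mu.-integrable `[a, b] (EFin \o g) ->
  int(a, b) (fun x => f x - g x) = int(a, b) f - int(a, b) g.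
Proof. by move=> fi gi; rewrite RintegralB. Qed.

Lemma integrable_sub_itv (a b c d : R) (g : R -> R) : a <= c -> d <= b ->
  mu.-integrable `[a, b] (EFin \o g) -> mu.-integrable `[c, d] (EFin \o g).
Proof.
move=> ac db; apply: integrableS => // x /=; rewrite !in_itv/=.
by move=> /andP[cx xd]; rewrite (le_trans ac cx) (le_trans xd db).
Qed.

(** Green's formula for a form P dx + Q dy whose cross derivatives agree at each
    point, with no continuity of these derivatives: Goursat's argument. The
    hypothesis compares increments of P and Q across rectangles that contain
    the point, which is what complex differentiability provides after a change
    of variables. Real parts and imaginary parts are treated separately, hence
    the real-valued P and Q. *)
Lemma goursat_rect (P Q : R -> R -> R) (a b H K : R) : 0 <= H -> 0 <= K ->
  (forall y : R, b <= y <= b + K ->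
     mu.-integrable `[a, a + H] (EFin \o (fun x => P x y))) ->
  (forall x : R, a <= x <= a + H -> mu.-integrable `[b, b + K] (EFin \o Q x)) ->
  (forall p q : R, a <= p <= a + H -> b <= q <= b + K -> exists c : R,
    forall e, 0 < e -> exists2 d, 0 < d & forall x0 x1 y0 y1 : R,
      a <= x0 -> x0 <= p <= x1 -> x1 <= a + H ->
      b <= y0 -> y0 <= q <= y1 -> y1 <= b + K ->
      x1 - x0 < d -> y1 - y0 < d ->
      (forall x : R, x0 <= x <= x1 -> `|P x y1 - P x y0 - c * (y1 - y0)|
          <= e * ((x1 - x0) + (y1 - y0))) /\
      (forall y : R, y0 <= y <= y1 -> `|Q x1 y - Q x0 y - c * (x1 - x0)|
          <= e * ((x1 - x0) + (y1 - y0)))) ->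
  int(b, b + K) (Q (a + H)) - int(b, b + K) (Q a) =
  int(a, a + H) (fun x => P x (b + K)) - int(a, a + H) (fun x => P x b).
Proof.
move=> H0 K0 iP iQ closed.
pose W x0 x1 y0 y1 := int(y0, y1) (fun y => Q x1 y - Q x0 y)
                      - int(x0, x1) (fun x => P x y1 - P x y0).
have iP' x0 x1 y0 y1 : a <= x0 -> x1 <= a + H -> b <= y0 -> y0 <= y1 -> y1 <= b + K ->
    mu.-integrable `[x0, x1] (EFin \o (fun x => P x y1 - P x y0)).
  move=> ax xa by0 yy yb.
  have i1 := integrable_sub_itv ax xa (iP y1 ltac:(lra)).
  have i2 := integrable_sub_itv ax xa (iP y0 ltac:(lra)).
  by have := integrableB _ i1 i2; apply.
have iQ' x0 x1 y0 y1 : a <= x0 -> x0 <= x1 -> x1 <= a + H -> b <= y0 -> y1 <= b + K ->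
    mu.-integrable `[y0, y1] (EFin \o (fun y => Q x1 y - Q x0 y)).
  move=> ax xx xa by0 yb.
  have i1 := integrable_sub_itv by0 yb (iQ x1 ltac:(lra)).
  have i2 := integrable_sub_itv by0 yb (iQ x0 ltac:(lra)).
  by have := integrableB _ i1 i2; apply.
suff W0 : W a (a + H) b (b + K) = 0.
  rewrite -int_sub; [|by apply: iQ; lra..].
  rewrite -int_sub; [|by apply: iP; lra..].
  by apply/eqP; rewrite -subr_eq0; exact/eqP.
have Wx x0 xm x1 y0 y1 : a <= x0 -> x0 <= xm -> xm <= x1 -> x1 <= a + H ->
   b <= y0 -> y0 <= y1 -> y1 <= b + K ->
   W x0 x1 y0 y1 = W x0 xm y0 y1 + W xm x1 y0 y1.
  move=> ax0 x0m xm1 x1a by0 y01 y1b; rewrite /W.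
  rewrite (@int_split x0 xm x1)//; last exact: iP'.
  have -> : int(y0, y1) (fun y => Q x1 y - Q x0 y) =
     int(y0, y1) (fun y => Q x1 y - Q xm y) + int(y0, y1) (fun y => Q xm y - Q x0 y).
    rewrite -RintegralD//.
    - by apply: eq_Rintegral => y _; rewrite addrA subrK.
    - by apply: iQ' => //; lra.
    - by apply: iQ' => //; lra.
  by ring.
have Wy x0 x1 y0 ym y1 : a <= x0 -> x0 <= x1 -> x1 <= a + H ->
   b <= y0 -> y0 <= ym -> ym <= y1 -> y1 <= b + K ->
   W x0 x1 y0 y1 = W x0 x1 y0 ym + W x0 x1 ym y1.
  move=> ax0 x01 x1a by0 y0m ym1 y1b; rewrite /W.
  rewrite (@int_split y0 ym y1)//; last exact: iQ'.
  have -> : int(x0, x1) (fun x => P x y1 - P x y0) =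
     int(x0, x1) (fun x => P x y1 - P x ym) + int(x0, x1) (fun x => P x ym - P x y0).
    rewrite -RintegralD//.
    - by apply: eq_Rintegral => y _; rewrite addrA subrK.
    - by apply: iP' => //; lra.
    - by apply: iP' => //; lra.
  by ring.
apply/eqP; rewrite -normr_le0 leNgt; apply/negP => W_gt0.
have [HK|HK] := leP (H + K) 0.
  have [Hz Kz] : H = 0 /\ K = 0 by split; lra.
  move: W_gt0; rewrite /W Hz Kz !addr0 !set_itv1.
  by rewrite !Rintegral_set1 subrr normr0 ltxx.
(* A nonzero defect W would, by bisection, leave arbitrarily small rectangles
   h x g with a defect of at least 4 e (h + g)^2, whereas differentiability at
   the limit point bounds it by e (h + g)^2. *)
pose e := `|W a (a + H) b (b + K)| / (H + K) ^+ 2 / 4.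
have e0 : 0 < e by rewrite !divr_gt0// exprn_gt0.
pose L k : R := 2 ^- k.
have LS k : L k = L k.+1 + L k.+1.
  by rewrite /L exprS invfM; field; rewrite expf_neq0.
have L0 k : 0 < L k by rewrite /L invr_gt0 exprn_gt0.
pose B k x y := [/\ a <= x, x + H * L k <= a + H, b <= y, y + K * L k <= b + K &
  4 * e * ((H + K) * L k) ^+ 2 <= `|W x (x + H * L k) y (y + K * L k)|].
have := @bisection2 _ a b H K B H0 K0.
case.
- rewrite /B /L expr0 invr1 !mulr1 !lexx; split => //.
  by rewrite /e; rewrite [4 * _]mulrC divfK// divfK// expf_neq0// gt_eqF.
- move=> k x y [ax xa yb by_ Wk].
  have HL : 0 <= H * L k.+1 by rewrite mulr_ge0// ltW.
  have KL : 0 <= K * L k.+1 by rewrite mulr_ge0// ltW.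
  have HS : H * L k = H * L k.+1 + H * L k.+1 by rewrite LS mulrDr.
  have KS : K * L k = K * L k.+1 + K * L k.+1 by rewrite LS mulrDr.
  rewrite -!/(L _).
  pose h := H * L k.+1; pose g := K * L k.+1; rewrite -/h -/g in HL KL HS KS *.
  have [//|noB] := pselect (exists s t : bool, B k.+1 (x + s%:R * h) (y + t%:R * g)).
  have sm (s t : bool) : `|W (x + s%:R * h) (x + s%:R * h + h)
      (y + t%:R * g) (y + t%:R * g + g)| < 4 * e * ((H + K) * L k.+1) ^+ 2.
    have sh : 0 <= s%:R * h <= h by clear -HL; case: (s); rewrite ?mul1r ?mul0r; lra.
    have tg : 0 <= t%:R * g <= g by clear -KL; case: (t); rewrite ?mul1r ?mul0r; lra.
    rewrite ltNge; apply/negP => le; apply: noB; exists s, t; rewrite /B -/h -/g.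
    by split=> //; clear -ax xa yb by_ sh tg HS KS; lra.
  have := sm true true; have := sm true false.
  have := sm false true; have := sm false false.
  rewrite !mul0r !mul1r !addr0 => s00 s01 s10 s11; exfalso; move: Wk.
  rewrite HS KS (LS k) => Wk.
  rewrite !addrA in Wk xa by_ HS KS.
  have [hx1 hx2 hx3] : [/\ x <= x + h, x + h <= x + h + h & a <= x + h].
    by clear -HL ax; split; lra.
  have [gy1 gy2 gy3] : [/\ y <= y + g, y + g <= y + g + g & y + g + g <= b + K].
    by clear -KL by_ KS; split; lra.
  have xah : x + h + h <= a + H by clear -xa HS; lra.
  move: Wk; rewrite (Wx x (x + h)) ?(le_trans gy1)//.
  rewrite (Wy _ _ y (y + g))//; last exact: le_trans xah.
  rewrite (Wy (x + h) _ y (y + g))//.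
  set A1 := W _ _ _ _ in s00 *; set A2 := W _ _ _ _ in s01 *.
  set A3 := W _ _ _ _ in s10 *; set A4 := W _ _ _ _ in s11 *.
  have := ler_normD (A1 + A2) (A3 + A4).
  have := ler_normD A3 A4; have := ler_normD A1 A2.
  have -> : 4 * e * ((H + K) * (L k.+1 + L k.+1)) ^+ 2 =
    4 * (4 * e * ((H + K) * L k.+1) ^+ 2) by ring.
  move: s00 s01 s10 s11; set u := 4 * e * _; clear.
  lra.
move=> p [q pq].
have [p_in q_in] : a <= p <= a + H /\ b <= q <= b + K.
  have [x [y [[ax xa yb by_ _] xp yq]]] := pq 0%N.
  move: xa by_ xp yq; rewrite /L expr0 invr1 !mulr1; lra.
have [c /(_ e e0) [d d0 close]] := closed p q p_in q_in.
have [k kd] : exists k, (H + K) * L k < d.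
  exists (Num.bound ((H + K) / d)).
  rewrite /L ltr_pdivrMr ?exprn_gt0// mulrC -ltr_pdivrMr//.
  apply: lt_trans (archi_boundP _) _; first by rewrite divr_ge0// ltW.
  by rewrite -natrX ltr_nat ltn_expl.
have [x [y [[ax xa yb by_ Wk] xp yq]]] := pq k.
have HL : 0 <= H * L k by rewrite mulr_ge0// ltW.
have KL : 0 <= K * L k by rewrite mulr_ge0// ltW.
rewrite -!/(L _) mulrDl in kd xp yq Wk.
pose h := H * L k; pose g := K * L k; rewrite -/h -/g in HL KL xp yq Wk kd xa by_.
have [] := close x (x + h) y (y + g);
  try by clear -xa by_ ax yb xp yq kd HL KL; lra.
have -> : x + h - x = h by ring.
have -> : y + g - y = g by ring.
move=> PP QQ.
pose I1 := int(y, y + g) (fun y => Q (x + h) y - Q x y).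
pose I2 := int(x, x + h) (fun x => P x (y + g) - P x y).
have h1 : `|I2 - c * g * (x + h - x)| <= e * (h + g) * (x + h - x).
  apply: int_le_cst PP; first by clear -HL; lra.
  by apply: iP' => //; clear -KL; lra.
have h2 : `|I1 - c * h * (y + g - y)| <= e * (h + g) * (y + g - y).
  apply: int_le_cst QQ; first by clear -KL; lra.
  by apply: iQ' => //; clear -HL; lra.
move: Wk h1 h2; rewrite -/h -/g -[W _ _ _ _]/(I1 - I2).
have -> : x + h - x = h by ring.
have -> : y + g - y = g by ring.
move=> Wk h1 h2.
have E : I1 - I2 = (I1 - c * h * g) - (I2 - c * g * h) by ring.
have := ler_normB (I1 - c * h * g) (I2 - c * g * h).
have : 0 < h + g by rewrite -mulrDl mulr_gt0.
rewrite -E => hg; have : 0 < e * (h + g) ^+ 2 by rewrite mulr_gt0// exprn_gt0.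
have E2 : e * (h + g) ^+ 2 = e * (h + g) * h + e * (h + g) * g by ring.
move: Wk h1 h2; rewrite -[4 * e * _]mulrA E2.
by clear; lra.
Qed.

End Goursat.

(** * Moduli, limits and derivatives of complex functions *)

Section ComplexBasics.
Variable R : realType.
Local Notation C := R[i].
Local Notation cj := (@conjc R).
Local Notation nm := (@Normc.normc R).
Local Notation Re := (@complex.Re R).
Local Notation Im := (@complex.Im R).
Implicit Types z w : C.

Lemma normcC z : `|z| = (nm z)%:C. Proof. by []. Qed.

Lemma nm_ge0 z : 0 <= nm z.
Proof. by rewrite -ler0c -normcC normr_ge0. Qed.

Lemma nmD z w : nm (z + w) <= nm z + nm w.
Proof. by rewrite -lecR rmorphD/=; exact: (@ler_normD _ C). Qed.

Lemma nmN z : nm (- z) = nm z.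
Proof. by apply: complexI; exact: (@normrN C C). Qed.

Lemma nmM z w : nm (z * w) = nm z * nm w.
Proof. exact: Normc.normcM. Qed.

Lemma nmB z w : nm (z - w) <= nm z + nm w.
Proof. by rewrite -(nmN w) nmD. Qed.

Lemma nm_distC z w : nm (z - w) = nm (w - z).
Proof. by rewrite -nmN opprB. Qed.

Lemma nmC (x : R) : nm x%:C = `|x|.
Proof. by rewrite /= expr0n addr0 sqrtr_sqr. Qed.

Lemma nm0 : nm 0 = 0. Proof. by rewrite (nmC 0) normr0. Qed.

Lemma nm_eq0 z : (nm z == 0) = (z == 0).
Proof. by apply/eqP/eqP => [/Normc.eq0_normc|->]; last exact: nm0. Qed.

Lemma nm_gt0 z : (0 < nm z) = (z != 0).
Proof. by rewrite lt0r nm_ge0 nm_eq0 andbT. Qed.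

Lemma nmV z : nm z^-1 = (nm z)^-1.
Proof. exact: Normc.normcV. Qed.

Lemma nm_conj z : nm (cj z) = nm z.
Proof. by apply: complexI; rewrite -!normcC normcJ. Qed.

Lemma sqr_nm z : nm z ^+ 2 = Re z ^+ 2 + Im z ^+ 2.
Proof. by case: z => a b /=; rewrite sqr_sqrtr// addr_ge0// sqr_ge0. Qed.

Lemma mulJ_nm z : z * cj z = (nm z ^+ 2)%:C.
Proof. by rewrite -sqr_normc normcC rmorphXn. Qed.

Lemma Re_le_nm z : `|Re z| <= nm z.
Proof. by have := normc_ge_Re z; rewrite normcC lecR. Qed.

Lemma Im_le_nm z : `|Im z| <= nm z.
Proof.
rewrite -(@ler_pXn2r _ 2%N)// ?nnegrE ?nm_ge0// sqr_nm.
by rewrite real_normK ?num_real// lerDr sqr_ge0.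
Qed.

Lemma nm_le_ReIm z : nm z <= `|Re z| + `|Im z|.
Proof.
rewrite -(@ler_pXn2r _ 2%N)// ?nnegrE ?nm_ge0 ?addr_ge0// sqr_nm.
rewrite sqrrD !real_normK ?num_real// -addrA lerD2l lerDr.
by rewrite mulrn_wge0// mulr_ge0.
Qed.

Lemma cReM z w : Re (z * w) = Re z * Re w - Im z * Im w.
Proof. by case: z w => a b [c d]. Qed.
Lemma cImM z w : Im (z * w) = Re z * Im w + Im z * Re w.
Proof. by case: z w => a b [c d]. Qed.
Lemma cReD z w : Re (z + w) = Re z + Re w. Proof. by case: z w => a b []. Qed.
Lemma cImD z w : Im (z + w) = Im z + Im w. Proof. by case: z w => a b []. Qed.
Lemma cReN z : Re (- z) = - Re z. Proof. by case: z. Qed.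
Lemma cImN z : Im (- z) = - Im z. Proof. by case: z. Qed.
Lemma cReB z w : Re (z - w) = Re z - Re w. Proof. by rewrite cReD cReN. Qed.
Lemma cImB z w : Im (z - w) = Im z - Im w. Proof. by rewrite cImD cImN. Qed.
Lemma cRe_conj z : Re (cj z) = Re z. Proof. by case: z. Qed.
Lemma cIm_conj z : Im (cj z) = - Im z. Proof. by case: z. Qed.
Lemma ReCM (r : R) z : Re (r%:C * z) = r * Re z.
Proof. by rewrite cReM /= mul0r subr0. Qed.
Lemma ImCM (r : R) z : Im (r%:C * z) = r * Im z.
Proof. by rewrite cImM /= mul0r addr0. Qed.

Lemma complexP z w : Re z = Re w -> Im z = Im w -> z = w.
Proof. by case: z w => a b [c d] /= -> ->. Qed.

Lemma cconjM z w : cj (z * w) = cj z * cj w.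
Proof. exact: (rmorphM (@conjc R)). Qed.
Lemma cconjB z w : cj (z - w) = cj z - cj w.
Proof. exact: (rmorphB (@conjc R)). Qed.
Lemma nm_cis t : nm (cis t) = 1.
Proof. by rewrite /= cos2Dsin2 sqrtr1. Qed.

Lemma cis_neq0 t : cis t != 0 :> C.
Proof. by rewrite -nm_gt0 nm_cis. Qed.

Lemma cisV t : (cis t)^-1 = cj (cis t) :> C.
Proof.
apply: (mulfI (cis_neq0 t)); rewrite divff ?cis_neq0// mulJ_nm nm_cis.
by rewrite expr1n.
Qed.

Lemma cinvE (z : C) : z^-1 = (nm z ^+ 2)^-1%:C * cj z.
Proof.
have [->|z0] := eqVneq z 0; first by rewrite invr0 nm0 expr0n invr0 mul0r.
apply: (mulfI z0); rewrite divff// mulrCA mulJ_nm -rmorphM/= mulVf//.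
by rewrite expf_neq0// nm_eq0.
Qed.

Lemma cvgC_nmP (T : Type) (F : set_system T) {FF : Filter F} (g : T -> C) (l : C) :
  (g x @[x --> F] --> (l : C^o)) <->
  (forall e : R, 0 < e -> \forall x \near F, nm (g x - l) < e).
Proof.
split => [gl e e0|gl].
  move/(@cvgrPdist_lt C C^o T F FF g l) : gl => gl.
  have := gl e%:C; rewrite ltcR => /(_ e0); apply: filterS => x.
  by rewrite distrC normcC ltcR.
apply/(@cvgrPdist_lt C C^o T F FF g l) => -[e e']; rewrite ltcE/= => /andP[/eqP e'0 e0].
apply: filterS (gl e e0) => x; rewrite distrC normcC e'0.
by rewrite -complexr0 ltcR.
Qed.

Lemma cvgC_ReIm (T : Type) (F : set_system T) {FF : Filter F} (g : T -> C) (l : C) :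
  (g x @[x --> F] --> (l : C^o)) <->
  ((Re (g x) @[x --> F] --> Re l) /\ (Im (g x) @[x --> F] --> Im l)).
Proof.
split => [/cvgC_nmP gl|[/cvgrPdist_lt gr /cvgrPdist_lt gi]].
  split; apply/cvgrPdist_lt => e /gl; apply: filterS => x; apply: le_lt_trans.
    by rewrite distrC -cReB Re_le_nm.
  by rewrite distrC -cImB Im_le_nm.
apply/cvgC_nmP => e e0; have e20 : 0 < e / 2 by rewrite divr_gt0.
apply: filterS2 (gr _ e20) (gi _ e20) => x.
rewrite distrC -cReB distrC -cImB => h1 h2.
by rewrite (le_lt_trans (nm_le_ReIm _))// (splitr e) ltrD.
Qed.

Lemma cvgC_cst (T : Type) (F : set_system T) {FF : Filter F} (a : C) :
  a @[x --> F] --> (a : C^o).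
Proof. exact: (@cvg_cst C^o). Qed.

Lemma cvgCM (T : Type) (F : set_system T) {FF : Filter F} (f g : T -> C) (a b : C) :
  f x @[x --> F] --> (a : C^o) -> g x @[x --> F] --> (b : C^o) ->
  f x * g x @[x --> F] --> (a * b : C^o).
Proof. by move=> fa gb; exact: (@cvgM C T F FF f g a b fa gb). Qed.

Lemma cvgCD (T : Type) (F : set_system T) {FF : Filter F} (f g : T -> C) (a b : C) :
  f x @[x --> F] --> (a : C^o) -> g x @[x --> F] --> (b : C^o) ->
  f x + g x @[x --> F] --> (a + b : C^o).
Proof. by move=> fa gb; exact: (@cvgD C C^o T F FF f g a b fa gb). Qed.

Lemma cvgCB (T : Type) (F : set_system T) {FF : Filter F} (f g : T -> C) (a b : C) :
  f x @[x --> F] --> (a : C^o) -> g x @[x --> F] --> (b : C^o) ->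
  f x - g x @[x --> F] --> (a - b : C^o).
Proof. by move=> fa gb; exact: (@cvgB C C^o T F FF f g a b fa gb). Qed.

Lemma cvgCV (T : Type) (F : set_system T) {FF : Filter F} (f : T -> C) (a : C) :
  a != 0 -> f x @[x --> F] --> (a : C^o) -> (f x)^-1 @[x --> F] --> (a^-1 : C^o).
Proof. by move=> a0 fa; exact: (@cvgV C T F FF f a a0 fa). Qed.

Lemma cvg_realC (T : Type) (F : set_system T) {FF : Filter F} (g : T -> R) (l : R) :
  g x @[x --> F] --> l -> (g x)%:C @[x --> F] --> (l%:C : C^o).
Proof. by move=> gl; apply/cvgC_ReIm; split => //=; exact: cvg_cst. Qed.

Lemma continuous_cis (t : R) : (cis s : C) @[s --> t] --> (cis t : C^o).
Proof.
apply/cvgC_ReIm; split; [exact: continuous_cos|exact: continuous_sin].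
Qed.

Lemma cis_2pi : cis (2 * pi) = 1 :> C.
Proof.
rewrite /cis; have -> : 2 * pi = pi *+ 2 :> R by rewrite mulr2n; ring.
by rewrite cos2pi sin2pi.
Qed.

Lemma cis_0 : cis 0 = 1 :> C. Proof. by rewrite /cis cos0 sin0. Qed.

(** Multiplying out the difference quotient makes the estimate usable at w = w0
    as well, and with real moduli in place of the norm of the complex field. *)
Lemma derivable_nmP (f : C -> C) w0 : derivable (f : C^o -> C^o) w0 1 ->
  exists c, forall e : R, 0 < e -> exists2 d : R, 0 < d & forall w, nm (w - w0) < d ->
    nm (f w - f w0 - c * (w - w0)) <= e * nm (w - w0).
Proof.
move=> /cvg_ex[/= c /cvgC_nmP cP]; exists c => e e0.
have := cP e e0 => -[[d d'] /=].
rewrite ltcE/= => /andP[/eqP d'0 d0] dP; exists d => // w wd.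
have [->|wne] := eqVneq w w0; first by rewrite !subrr mulr0 subrr nm0 mulr0.
have w0' : w - w0 != 0 by rewrite subr_eq0.
have := dP (w - w0); rewrite /ball/= sub0r normrN normcC d'0 -complexr0 ltcR.
move=> /(_ wd w0').
rewrite [_ *: 1]mulr1 subrK => /ltW.
rewrite [_ *: (_ - _)]mulrC -(ler_pM2r (_ : 0 < nm (w - w0))) ?nm_gt0//.
by rewrite -nmM mulrBl divfK.
Qed.

Lemma derivable_cvg (f : C -> C) w0 : derivable (f : C^o -> C^o) w0 1 ->
  f w @[w --> (w0 : C^o)] --> (f w0 : C^o).
Proof. by move=> /derivable1_diffP/differentiable_continuous. Qed.

Lemma cvgC_comp (T : Type) (F : set_system T) {FF : Filter F}
    (f : C -> C) (g : T -> C) (l : C) :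
  derivable (f : C^o -> C^o) l 1 -> g x @[x --> F] --> (l : C^o) ->
  f (g x) @[x --> F] --> (f l : C^o).
Proof.
move=> /derivable_cvg fl gl.
exact: cvg_comp gl fl.
Qed.

Lemma cis_deriv (q : R) : forall e : R, 0 < e -> exists2 d : R, 0 < d & forall y : R,
  `|y - q| < d -> nm (cis y - cis q - 'i * cis q * (y - q)%:C) <= e * `|y - q|.
Proof.
have der (f : R -> R) (c : R) : is_derive q 1 f c -> forall e, 0 < e ->
    exists2 d : R, 0 < d & forall y, `|y - q| < d ->
      `|f y - f q - c * (y - q)| <= e * `|y - q|.
  move=> [df dc] e e0.
  have /cvgrPdist_lt cP : h^-1 *: (f (h *: 1 + q) - f q) @[h --> 0^'] --> c.
    by rewrite -dc; exact: df.
  have [d /= d0 dP] := cP e e0.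
  exists d => // y yd; have [->|yne] := eqVneq y q.
    by rewrite !subrr mulr0 subrr normr0 mulr0.
  have := dP (y - q); rewrite /= sub0r normrN => /(_ yd).
  rewrite subr_eq0 => /(_ yne).
  rewrite [_ *: 1]mulr1 subrK => /ltW.
  rewrite distrC [_ *: (_ - _)]mulrC -(ler_pM2r (_ : 0 < `|y - q|)).
    by rewrite -normrM mulrBl divfK// subr_eq0.
  by rewrite normr_gt0 subr_eq0.
move=> e e0; have e20 : 0 < e / 2 by rewrite divr_gt0.
have [d1 d10 h1] := der _ _ (is_derive_cos q) _ e20.
have [d2 d20 h2] := der _ _ (is_derive_sin q) _ e20.
exists (Num.min d1 d2); first by rewrite lt_min d10.
move=> y; rewrite lt_min => /andP[/h1 {}h1 /h2 {}h2].
apply: le_trans (nm_le_ReIm _) _.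
rewrite (splitr e) mulrDl; apply: lerD.
  by rewrite /= !(mul0r, mul1r, mulr0, add0r, subr0, addr0, oppr0, sub0r).
by rewrite /= !(mul0r, mul1r, mulr0, add0r, subr0, addr0, oppr0, sub0r).
Qed.

End ComplexBasics.

(** * Contraction of the circle to a point *)

Section Cauchy.
Variable R : realType.
Local Notation C := R[i].
Local Notation nm := (@Normc.normc R).
Local Notation mu := (@lebesgue_measure R).
Local Notation "'int' ( a , b ) g" := (\int[mu]_(x in `[a, b]%classic) g x)
  (at level 10, g at level 8).

Definition holomorphic (rho : R) (f : C -> C) :=
  forall z, nm z < rho -> derivable (f : C^o -> C^o) z 1.

Lemma integrable_cont (a b : R) (g : R -> R) :
  (forall x : R, a <= x <= b -> g y @[y --> x] --> g x) ->
  mu.-integrable `[a, b] (EFin \o g).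
Proof.
move=> gc; apply: continuous_compact_integrable; first exact: segment_compact.
by apply: continuous_in_subspaceT => x; rewrite inE/= in_itv/=; exact: gc.
Qed.

(** The homotopy that contracts the unit circle to z. *)
Definition circ_param (z : C) (t s : R) : C := z + t%:C * (cis s - z).
(** On the unit circle, dw / (2 i pi (w - z)) is this density times the normalized
    Lebesgue measure. *)
Definition cauchy_kernel (z : C) (s : R) : C := cis s / (cis s - z).

Lemma nm_circ_param z t s : nm z < 1 -> 0 <= t <= 1 -> nm (circ_param z t s) <= 1.
Proof.
move=> z1 /andP[t0 t1].
have -> : circ_param z t s = (1 - t)%:C * z + t%:C * cis s.
  by rewrite /circ_param rmorphB rmorph1; ring.
apply: le_trans (nmD _ _) _; rewrite !nmM !nmC nm_cis mulr1 !ger0_norm ?subr_ge0//.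
have := nm_ge0 z; nra.
Qed.

Lemma cis_subz z s : nm z < 1 -> 1 - nm z <= nm (cis s - z).
Proof.
move=> z1; have := nmD (cis s - z) z; rewrite subrK nm_cis; lra.
Qed.

Lemma cis_subz_neq0 z s : nm z < 1 -> cis s - z != 0.
Proof.
by move=> z1; rewrite -nm_gt0 (lt_le_trans _ (cis_subz s z1))// subr_gt0.
Qed.

Lemma nm_cauchy_kernel z s : nm z < 1 -> nm (cauchy_kernel z s) <= (1 - nm z)^-1.
Proof.
move=> z1; rewrite nmM nm_cis mul1r nmV lef_pV2 ?posrE ?subr_gt0//.
  exact: cis_subz.
by rewrite nm_gt0 cis_subz_neq0.
Qed.

Lemma continuous_cauchy_kernel z s : nm z < 1 ->
  cauchy_kernel z t @[t --> s] --> (cauchy_kernel z s : C^o).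
Proof.
move=> z1; rewrite /cauchy_kernel; apply: cvgCM; first exact: continuous_cis.
apply: cvgCV; first exact: cis_subz_neq0.
by apply: cvgCB; [exact: continuous_cis|exact: cvgC_cst].
Qed.

Section Functional.
(* L is either the real part or the imaginary part. *)
Variable L : C -> R.
Hypothesis LB : forall z w, L (z - w) = L z - L w.
Hypothesis LC : forall z r, L (z * r%:C) = L z * r.
Hypothesis Ln : forall z, `|L z| <= nm z.

Lemma cvgL (T : Type) (F : set_system T) {FF : Filter F} (g : T -> C) (l : C) :
  g x @[x --> F] --> (l : C^o) -> L (g x) @[x --> F] --> L l.
Proof.
move=> /cvgC_nmP gl; apply/cvgrPdist_lt => e /gl; apply: filterS => x.
by apply: le_lt_trans; rewrite -LB nm_distC Ln.
Qed.

(** Only the annulus between the circles of parameters tau and 1 is swept, so the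
    pole at z is never met; the sides s = 0 and s = 2 pi of the rectangle of
    parameters cancel by periodicity. *)
Lemma circle_deformation (rho : R) (f : C -> C) (z : C) (tau : R) : 1 < rho ->
  holomorphic rho f -> nm z < 1 -> 0 < tau <= 1 ->
  int(0, 2 * pi) (fun s => L (f (cis s) * cauchy_kernel z s)) =
  int(0, 2 * pi) (fun s => L (f (circ_param z tau s) * cauchy_kernel z s)).
Proof.
move=> rho1 fh z1 /andP[tau0 tau1].
have pi20 : 0 <= 2 * pi :> R by rewrite mulr_ge0// pi_ge0.
(* For w = z + t (e^{is} - z), the form f(w) dw / (w - z) is
   f(w) dt / t + i f(w) e^{is} / (e^{is} - z) ds; P dt + Q ds is L of -i times
   this form. *)
pose P (t s : R) := L (- 'i * f (circ_param z t s) * (t^-1)%:C).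
pose Q (t s : R) := L (f (circ_param z t s) * cauchy_kernel z s).
have fc (t s : R) : 0 <= t <= 1 -> derivable (f : C^o -> C^o) (circ_param z t s) 1.
  by move=> t01; apply: fh; apply: le_lt_trans rho1; exact: nm_circ_param.
have cpt (t s : R) : circ_param z y s @[y --> t] --> (circ_param z t s : C^o).
  apply: cvgCD; first exact: cvgC_cst.
  by apply: cvgCM; [apply: cvg_realC; exact: cvg_id|exact: cvgC_cst].
have cps (t s : R) : circ_param z t y @[y --> s] --> (circ_param z t s : C^o).
  apply: cvgCD; first exact: cvgC_cst.
  apply: cvgCM; first exact: cvgC_cst.
  by apply: cvgCB; [exact: continuous_cis|exact: cvgC_cst].
have := @goursat_rect R P Q tau 0 (1 - tau) (2 * pi).
have -> : tau + (1 - tau) = 1 by ring.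
rewrite !add0r subr_ge0 tau1 => /(_ isT pi20).
have iP y : 0 <= y <= 2 * pi -> mu.-integrable `[tau, 1] (EFin \o P^~ y).
  move=> _; apply: integrable_cont => t /andP[taut t1]; apply: cvgL.
  have t0 : 0 < t by exact: lt_le_trans taut.
  apply: cvgCM.
    apply: cvgCM; first exact: cvgC_cst.
    by apply: cvgC_comp (cpt t y); apply: fc; rewrite ltW.
  by apply: cvg_realC; apply: cvgV; rewrite ?gt_eqF.
have iQ x : tau <= x <= 1 -> mu.-integrable `[0, 2 * pi] (EFin \o Q x).
  move=> /andP[taux x1]; apply: integrable_cont => s _; apply: cvgL.
  apply: cvgCM; last exact: continuous_cauchy_kernel.
  apply: cvgC_comp (cps x s); apply: fc.
  by rewrite x1 andbT (le_trans (ltW tau0)).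
move=> /(_ iP iQ).
have P0 : int(tau, 1) (P^~ (2 * pi)) = int(tau, 1) (P^~ 0).
  by apply: eq_Rintegral => t _; rewrite /P /circ_param cis_2pi cis_0.
rewrite P0 subrr => H.
suff /H /eqP : forall p q : R, tau <= p <= 1 -> 0 <= q <= 2 * pi ->
    exists c : R, forall e : R, 0 < e -> exists2 d, 0 < d & forall x0 x1 y0 y1 : R,
      tau <= x0 -> x0 <= p <= x1 -> x1 <= 1 ->
      0 <= y0 -> y0 <= q <= y1 -> y1 <= 2 * pi ->
      x1 - x0 < d -> y1 - y0 < d ->
      (forall x : R, x0 <= x <= x1 -> `|P x y1 - P x y0 - c * (y1 - y0)|
          <= e * ((x1 - x0) + (y1 - y0))) /\
      (forall y : R, y0 <= y <= y1 -> `|Q x1 y - Q x0 y - c * (x1 - x0)|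
          <= e * ((x1 - x0) + (y1 - y0))).
  rewrite subr_eq0 => /eqP <-; apply: eq_Rintegral => s _.
  by rewrite /Q /circ_param rmorph1 mul1r addrC subrK.
move=> {H P0 iP iQ cpt cps} p q /andP[taup p1] _.
have p0 : 0 < p by exact: lt_le_trans taup.
have [c' c'P] := derivable_nmP (fc p q ltac:(by rewrite p1 ltW)).
(* Both cross derivatives are f'(w) e^{is}. *)
exists (L (c' * cis q)) => e e0.
pose N : R := nm c'; have N0 : 0 <= N by exact: nm_ge0.
pose M : R := tau^-1 + (1 - nm z)^-1.
have Mtau : tau^-1 <= M by rewrite lerDl invr_ge0 subr_ge0 ltW.
have Mz : (1 - nm z)^-1 <= M by rewrite lerDr invr_ge0 ltW.
have M0 : 0 < M by apply: lt_le_trans Mtau; rewrite invr_gt0.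
pose e1 : R := e / (8 * M); have e10 : 0 < e1 by rewrite divr_gt0// mulr_gt0.
pose e2 := Num.min 1 (e / (2 * (N + 1))).
have e20 : 0 < e2 by rewrite lt_min ltr01 divr_gt0// mulr_gt0// ltr_wpDl.
have e21 : e2 <= 1 by rewrite /e2 ge_min lexx.
have e2N : N * e2 <= e / 2.
  apply: (@le_trans _ _ (N * (e / (2 * (N + 1))))).
    by rewrite ler_wpM2l// /e2 ge_min lexx orbT.
  have -> : N * (e / (2 * (N + 1))) = e / 2 * (N / (N + 1)).
    by field; rewrite gt_eqF// ltr_wpDl.
  have Nle : N / (N + 1) <= 1 by rewrite ler_pdivrMr ?mul1r ?lerDl// ltr_wpDl.
  by rewrite ler_piMr// divr_ge0// ltW.
have [d1 d10 d1P] := c'P e1 e10.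
have [d2 d20 d2P] := cis_deriv q e20.
exists (Num.min (d1 / 4) (Num.min d2 (e2 / 2))).
  by rewrite !lt_min d20 !divr_gt0.
move=> x0 x1 y0 y1 taux0 /andP[x0p px1] x11 _ /andP[y0q qy1] _.
rewrite !lt_min => /andP[dx1 /andP[dx2 dx3]] /andP[dy1 /andP[dy2 dy3]].
set S := x1 - x0 + (y1 - y0).
have nmi : nm 'i = 1 by rewrite /= expr0n expr1n add0r sqrtr1.
have cisq (y : R) : y0 <= y <= y1 -> nm (cis y - cis q - 'i * cis q * (y - q)%:C)
    <= e2 * `|y - q| /\ `|y - q| <= y1 - y0.
  move=> yy; have yd : `|y - q| <= y1 - y0 by rewrite ler_norml; clear -yy y0q qy1; apply/andP; split; lra.
  by split=> //; apply: d2P; apply: le_lt_trans dy2.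
have cisq2 (y : R) : y0 <= y <= y1 -> nm (cis y - cis q) <= 2 * (y1 - y0).
  move=> /cisq[h1 h2].
  have := nmD (cis y - cis q - 'i * cis q * (y - q)%:C) ('i * cis q * (y - q)%:C).
  rewrite subrK !nmM nm_cis nmC nmi !mul1r => h3.
  have h4 : e2 * `|y - q| <= `|y - q| by rewrite ler_piMl.
  by clear -h1 h2 h3 h4; lra.
pose E (x y : R) := f (circ_param z x y) - f (circ_param z p q)
               - c' * (circ_param z x y - circ_param z p q).
have EP (x y : R) : x0 <= x <= x1 -> y0 <= y <= y1 -> nm (E x y) <= e1 * (2 * S).
  move=> xx yy; have dd : nm (circ_param z x y - circ_param z p q) <= 2 * S.
    have -> : circ_param z x y - circ_param z p q =
        (x - p)%:C * (cis y - z) + p%:C * (cis y - cis q).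
      by rewrite /circ_param rmorphB; ring.
    apply: le_trans (nmD _ _) _; rewrite !nmM !nmC.
    have h1 : `|x - p| <= x1 - x0.
      by rewrite ler_norml; clear -xx x0p px1; apply/andP; split; lra.
    have h2 : nm (cis y - z) <= 2.
      by apply: le_trans (nmB _ _) _; rewrite nm_cis; lra.
    have := nm_ge0 (cis y - z); have := nm_ge0 (cis y - cis q).
    have := cisq2 y yy; rewrite (ger0_norm (ltW p0)) /S.
    have := normr_ge0 (x - p); clear -h1 h2 p0 p1 x0p px1 y0q qy1; nra.
  apply: le_trans (d1P _ _) _; last by rewrite ler_wpM2l// ltW.
  apply: le_lt_trans dd _; rewrite /S; clear -dx1 dy1 d10; lra.
have S0 : 0 <= S by rewrite /S; clear -x0p px1 y0q qy1; lra.
have eS : e1 * (2 * S) * 2 * M = e / 2 * S.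
  by rewrite /e1; field; rewrite gt_eqF.
split.
- move=> x xx; have x_gt0 : 0 < x by clear -tau0 taux0 xx; lra.
  have y0y : y0 <= y0 <= y1 by clear -y0q qy1; lra.
  have y1y : y0 <= y1 <= y1 by clear -y0q qy1; lra.
  rewrite /P -LB -LC -LB; apply: le_trans (Ln _) _.
  pose E' y := cis y - cis q - 'i * cis q * (y - q)%:C.
  have -> : - 'i * f (circ_param z x y1) * (x^-1)%:C -
     - 'i * f (circ_param z x y0) * (x^-1)%:C - c' * cis q * (y1 - y0)%:C =
     - 'i * ((E x y1 - E x y0) * (x^-1)%:C) + - 'i * (c' * (E' y1 - E' y0)).
    have i2 : 'i * 'i = -1 :> C by rewrite -expr2 sqr_i.
    have x2 : x%:C * x^-1%:C = 1 :> C by rewrite -rmorphM/= mulfV ?gt_eqF.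
    rewrite /E /E' /circ_param !rmorphB /=; ring: i2 x2.
  apply: le_trans (nmD _ _) _; rewrite !nmM nmN nmC nmi.
  rewrite !mul1r (splitr e) mulrDl; apply: lerD.
    rewrite -eS; apply: ler_pM; rewrite ?nm_ge0 ?normr_ge0//.
      apply: le_trans (nmB _ _) _.
      have -> : e1 * (2 * S) * 2 = e1 * (2 * S) + e1 * (2 * S) by ring.
      by apply: lerD; exact: EP.
    rewrite gtr0_norm ?invr_gt0//; apply: le_trans Mtau.
    by rewrite lef_pV2 ?posrE//; clear -taux0 xx; lra.
  have hE : nm (E' y1 - E' y0) <= e2 * (y1 - y0).
    apply: le_trans (nmB _ _) _.
    have [h1 _] := cisq _ y1y; have [h0 _] := cisq _ y0y.
    apply: le_trans (lerD h1 h0) _.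
    rewrite ger0_norm ?subr_ge0// ler0_norm ?subr_le0//; clear; lra.
  apply: (@le_trans _ _ (N * (e2 * (y1 - y0)))); first exact: ler_wpM2l.
  rewrite mulrA; apply: ler_pM => //; rewrite ?mulr_ge0 ?(ltW e20)//; rewrite /S; clear -x0p px1 y0q qy1; lra.
- move=> y yy.
  have x0x : x0 <= x0 <= x1 by clear -x0p px1; lra.
  have x1x : x0 <= x1 <= x1 by clear -x0p px1; lra.
  rewrite /Q -LB -LC -LB; apply: le_trans (Ln _) _.
  have -> : f (circ_param z x1 y) * cauchy_kernel z y -
     f (circ_param z x0 y) * cauchy_kernel z y - c' * cis q * (x1 - x0)%:C =
     (E x1 y - E x0 y) * cauchy_kernel z y + c' * (cis y - cis q) * (x1 - x0)%:C.
    rewrite /E /cauchy_kernel /circ_param !rmorphB /=; field.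
    exact: cis_subz_neq0.
  apply: le_trans (nmD _ _) _; rewrite nmM (nmM (_ * _)) (nmM c') nmC.
  rewrite (splitr e) mulrDl; apply: lerD.
    rewrite -eS; apply: ler_pM; rewrite ?nm_ge0 ?normr_ge0//.
      apply: le_trans (nmB _ _) _.
      have -> : e1 * (2 * S) * 2 = e1 * (2 * S) + e1 * (2 * S) by ring.
      by apply: lerD; exact: EP.
    by apply: le_trans Mz; exact: nm_cauchy_kernel.
  apply: ler_pM; rewrite ?mulr_ge0 ?nm_ge0//.
    apply: le_trans e2N; apply: ler_wpM2l => //.
    by apply: le_trans (cisq2 _ yy) _; lra.
  rewrite ger0_norm; rewrite /S; lra.
Qed.

End Functional.
End Cauchy.

(** * Integrals over the circle *)

Section CircleMeasure.
Variable R : realType.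
Local Notation C := R[i].
Local Notation cj := (@conjc R).
Local Notation Re := (@complex.Re R).
Local Notation Im := (@complex.Im R).
Local Notation mu := (@lebesgue_measure R).
Local Notation m := (@circle_measure R).
Local Notation "'int' ( a , b ) g" := (\int[mu]_(x in `[a, b]%classic) g x)
  (at level 10, g at level 8).

Lemma pi2_gt0 : 0 < 2 * pi :> R.
Proof. by rewrite mulr_gt0// pi_gt0. Qed.

Lemma circle_measureT : m setT = 1%E.
Proof.
rewrite /circle_measure /= /mscale/= /mrestr/= setTI lebesgue_measure_itv/=.
rewrite lte_fin pi2_gt0 -EFinB subr0 -EFinM mulVf//.
by rewrite gt_eqF// pi2_gt0.
Qed.

Lemma circle_measureC : m (~` `[0, 2 * pi]%classic) = 0%E.
Proof.
by rewrite /circle_measure /= /mscale/= /mrestr/= setICl measure0 mule0.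
Qed.

Lemma circle_ge0_integral (f : R -> \bar R) : measurable_fun setT f ->
  (forall x, 0 <= f x)%E ->
  (\int[m]_x f x = ((2 * pi)^-1)%R%:E * \int[mu]_(x in `[0%R, (2 * pi)%R]%classic) f x)%E.
Proof.
move=> mf f0; rewrite (ge0_negligible_integral _ _ _ _ circle_measureC)//; last first.
  exact: measurableC.
rewrite setDE setCK setTI ge0_integral_mscale//=; last exact: measurable_funTS.
congr (_ * _)%E; apply: eq_measure_integral => A mA A01.
by rewrite /= /mrestr setIidl.
Qed.

Lemma circle_integrable (g : R -> R) : measurable_fun setT g ->
  mu.-integrable `[0, 2 * pi] (EFin \o g) -> m.-integrable setT (EFin \o g).
Proof.
move=> mg /integrableP[_ ig].
have mEg : measurable_fun setT (EFin \o g) by exact/measurable_EFinP.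
apply/integrableP; split => //.
rewrite circle_ge0_integral; [|exact: measurableT_comp|by []].
by apply: lte_mul_pinfty => //; rewrite lee_fin inv_2pi_ge0.
Qed.

Lemma circle_Rintegral (g : R -> R) : measurable_fun setT g ->
  mu.-integrable `[0, 2 * pi] (EFin \o g) ->
  \int[m]_x g x = (2 * pi)^-1 * int(0, 2 * pi) g.
Proof.
move=> mg ig; rewrite /Rintegral integralE [in RHS]integralE.
have mEg : measurable_fun setT (EFin \o g) by exact/measurable_EFinP.
rewrite !circle_ge0_integral//; [|exact: measurable_funeneg|exact: measurable_funepos].
have f1 : (\int[mu]_(x in `[0%R, (2 * pi)%R]%classic) (EFin \o g)^\+ x)%E \is a fin_num.
  by rewrite ge0_fin_numE ?integral_ge0//; apply: integral_funepos_lt_pinfty.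
have f2 : (\int[mu]_(x in `[0%R, (2 * pi)%R]%classic) (EFin \o g)^\- x)%E \is a fin_num.
  by rewrite ge0_fin_numE ?integral_ge0//; apply: integral_funeneg_lt_pinfty.
rewrite -muleBr//; last by apply: fin_num_adde_defl; rewrite fin_numN.
by rewrite fineM// fin_numB f1.
Qed.

Definition cintegrable (g : R -> C) :=
  m.-integrable setT (EFin \o (Re \o g)) /\
  m.-integrable setT (EFin \o (Im \o g)).

Lemma cintegralZ (c : C) (g : R -> C) : cintegrable g ->
  cintegral (fun t => c * g t) = c * cintegral g.
Proof.
move=> [g1 g2]; apply: complexP; rewrite ?cReM ?cImM /cintegral /=.
  rewrite -!RintegralZl// -RintegralB//.
  - by apply: eq_Rintegral => t _; rewrite cReM.
  - exact: (integrableZl measurableT (Re c) g1).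
  - exact: (integrableZl measurableT (Im c) g2).
rewrite -!RintegralZl// -RintegralD//.
- by apply: eq_Rintegral => t _; rewrite cImM.
- exact: (integrableZl measurableT (Re c) g2).
- exact: (integrableZl measurableT (Im c) g1).
Qed.

Lemma eq_cintegral (f g : R -> C) : f =1 g -> cintegral f = cintegral g.
Proof. by move=> /funext ->. Qed.

Lemma cintegral_cst (c : C) : cintegral (fun=> c) = c.
Proof.
have mT : fine (m setT) = 1 by rewrite circle_measureT.
apply: complexP; rewrite /cintegral /= Rintegral_cst//; first by rewrite mT mulr1.
by rewrite mT mulr1.
Qed.

Lemma cintegral_conj (g : R -> C) : cintegrable g ->
  cintegral (fun t => cj (g t) ) = cj (cintegral g).
Proof.
move=> [_ g2]; apply: complexP; rewrite ?cRe_conj ?cIm_conj /cintegral /=.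
  by apply: eq_Rintegral => t _; rewrite cRe_conj.
rewrite -mulN1r -RintegralZl//; apply: eq_Rintegral => t _.
by rewrite cIm_conj mulN1r.
Qed.

Lemma measurable_fun_cont (g : R -> R) :
  (forall t, g s @[s --> t] --> g t) -> measurable_fun setT g.
Proof. by move=> gc; exact: continuous_measurable_fun. Qed.

Definition ccontinuous (g : R -> C) :=
  forall t, g s @[s --> t] --> (g t : C^o).

Lemma ccontinuous_integrable (g : R -> C) : ccontinuous g -> cintegrable g.
Proof.
move=> gc; split; (apply: circle_integrable;
  [apply: measurable_fun_cont|apply: integrable_cont]) => t; rewrite /=;
  have /cvgC_ReIm[] := gc t; by [].
Qed.

Lemma cintegral_cont (g : R -> C) : ccontinuous g ->
  cintegral g = ((2 * pi)^-1 * int(0, 2 * pi) (Re \o g)) +i*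
                ((2 * pi)^-1 * int(0, 2 * pi) (Im \o g)).
Proof.
move=> gc; rewrite /cintegral !circle_Rintegral//.
all: try (apply: measurable_fun_cont => t; by have /cvgC_ReIm[] := gc t).
all: by apply: integrable_cont => t _; have /cvgC_ReIm[] := gc t.
Qed.

End CircleMeasure.

(** * The formulas of Cauchy and Poisson *)

Section Poisson.
Variable R : realType.
Local Notation C := R[i].
Local Notation cj := (@conjc R).
Local Notation nm := (@Normc.normc R).
Local Notation Re := (@complex.Re R).
Local Notation Im := (@complex.Im R).
Local Notation mu := (@lebesgue_measure R).
Local Notation m := (@circle_measure R).
Local Notation "'int' ( a , b ) g" := (\int[mu]_(x in `[a, b]%classic) g x)
  (at level 10, g at level 8).

Lemma holomorphic_ccontinuous (rho : R) (f : C -> C) : 1 < rho ->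
  holomorphic rho f -> ccontinuous (f \o @cis R).
Proof.
move=> rho1 fh t; apply: cvgC_comp; last exact: continuous_cis.
by apply: fh; rewrite nm_cis.
Qed.

Lemma ccontinuousM (f g : R -> C) : ccontinuous f -> ccontinuous g ->
  ccontinuous (fun t => f t * g t).
Proof. by move=> fc gc t; apply: cvgCM; [exact: fc|exact: gc]. Qed.

Lemma ccontinuous_kernel z : nm z < 1 -> ccontinuous (cauchy_kernel z).
Proof. by move=> z1 t; exact: continuous_cauchy_kernel. Qed.

(** Contract the circle to z and use the continuity of f at z; the kernel depends
    on the angle only, not on the parameter of the contraction. *)
Lemma circle_mean (L : C -> R) (rho : R) (f : C -> C) (z : C) :
  (forall z w, L (z - w) = L z - L w) -> (forall z r, L (z * r%:C) = L z * r) ->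
  (forall z, `|L z| <= nm z) ->
  1 < rho -> holomorphic rho f -> nm z < 1 ->
  int(0, 2 * pi) (fun s => L (f (cis s) * cauchy_kernel z s)) =
  int(0, 2 * pi) (fun s => L (f z * cauchy_kernel z s)).
Proof.
move=> LB LC Ln rho1 fh z1.
have pi20 : 0 < 2 * pi :> R by exact: pi2_gt0.
have M0 : 0 < (1 - nm z)^-1 by rewrite invr_gt0 subr_gt0.
set I1 := LHS; set I2 := RHS.
have close e : 0 < e -> `|I1 - I2| <= e.
  move=> e0; pose e1 : R := e / ((1 - nm z)^-1 * (2 * pi)).
  have e10 : 0 < e1 by rewrite divr_gt0// mulr_gt0.
  have /derivable_cvg/cvgC_nmP/(_ e1 e10) : derivable (f : C^o -> C^o) z 1.
    by apply: fh; exact: lt_trans rho1.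
  move=> [[d d'] /=]; rewrite ltcE/= => /andP[/eqP d'0 d0] dP.
  pose tau : R := Num.min 1 (d / 4).
  have tau0 : 0 < tau by rewrite lt_min ltr01 divr_gt0.
  have tau1 : 0 < tau <= 1 by rewrite tau0 ge_min lexx.
  have tau1' : 0 <= tau <= 1 by case/andP: tau1 => /ltW -> ->.
  rewrite /I1 (circle_deformation LB LC Ln rho1 fh z1 tau1) /I2.
  rewrite -int_sub; first last.
  - apply: integrable_cont => s _; apply: (cvgL LB Ln).
    by apply: cvgCM; [exact: cvgC_cst|exact: ccontinuous_kernel].
  - apply: integrable_cont => s _; apply: (cvgL LB Ln).
    apply: cvgCM; last exact: ccontinuous_kernel.
    apply: cvgC_comp.
      by apply: fh; apply: le_lt_trans rho1; exact: nm_circ_param.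
    apply: cvgCD; first exact: cvgC_cst.
    apply: cvgCM; first exact: cvgC_cst.
    by apply: cvgCB; [exact: continuous_cis|exact: cvgC_cst].
  set g := fun s => _ - _.
  have ig : mu.-integrable `[0, 2 * pi] (EFin \o g).
    apply: integrable_cont => s _; rewrite /g.
    apply: cvgB; apply: (cvgL LB Ln).
      apply: cvgCM; last exact: ccontinuous_kernel.
      apply: cvgC_comp.
        by apply: fh; apply: le_lt_trans rho1; exact: nm_circ_param.
      apply: cvgCD; first exact: cvgC_cst.
      apply: cvgCM; first exact: cvgC_cst.
      by apply: cvgCB; [exact: continuous_cis|exact: cvgC_cst].
    by apply: cvgCM; [exact: cvgC_cst|exact: ccontinuous_kernel].
  have gle : forall s, 0 <= s <= 2 * pi -> `|g s - 0| <= e1 * (1 - nm z)^-1.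
    move=> s _; rewrite subr0 /g -LB -mulrBl; apply: le_trans (Ln _) _.
    rewrite nmM; apply: ler_pM; rewrite ?nm_ge0 ?nm_cauchy_kernel//.
    apply: ltW; apply: dP; rewrite /ball/= d'0 distrC normcC -complexr0 ltcR.
    rewrite /circ_param addrAC subrr add0r nmM nmC (ger0_norm (ltW tau0)).
    have h : nm (cis s - z) <= 2.
      by apply: le_trans (nmB _ _) _; rewrite nm_cis; clear -z1; lra.
    have h2 : tau <= d / 4 by rewrite ge_min lexx orbT.
    apply: (@le_lt_trans _ _ (d / 4 * 2)); first by apply: ler_pM => //; [exact: ltW|exact: nm_ge0].
    by clear -d0; lra.
  have := @int_le_cst _ 0 (2 * pi) (e1 * (1 - nm z)^-1) 0 g (ltW pi20) ig gle.
  rewrite mul0r !subr0 => /le_trans; apply.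
  by rewrite /e1 -mulrA divfK// gt_eqF// mulr_gt0.
apply/eqP; rewrite -subr_eq0 -normr_le0; apply/ler_addgt0Pr => e /close.
by rewrite add0r.
Qed.

Lemma cintegral_kernel_mean (rho : R) (f : C -> C) (z : C) :
  1 < rho -> holomorphic rho f -> nm z < 1 ->
  cintegral (fun s => f (cis s) * cauchy_kernel z s) =
  f z * cintegral (cauchy_kernel z).
Proof.
move=> rho1 fh z1; rewrite -cintegralZ; last first.
  by apply: ccontinuous_integrable; exact: ccontinuous_kernel.
rewrite !cintegral_cont; first last.
- by apply: ccontinuousM; [exact: (holomorphic_ccontinuous rho1 fh)|
    exact: ccontinuous_kernel].
- by apply: ccontinuousM; [move=> t; exact: cvgC_cst|exact: ccontinuous_kernel].
rewrite /comp /= (@circle_mean Re rho f z)//; first last.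
- exact: Re_le_nm.
- by move=> w r; rewrite mulrC ReCM mulrC.
- exact: cReB.
rewrite (@circle_mean Im rho f z)//.
- exact: cImB.
- by move=> w r; rewrite mulrC ImCM mulrC.
- exact: Im_le_nm.
Qed.

Lemma derivable_aff (a b z : C) : derivable ((fun w => a + b * w) : C^o -> C^o) z 1.
Proof.
apply: (@derivableD C C^o C^o (cst a) (fun w => b * w)); first exact: derivable_cst.
apply: (@derivableM C C^o (cst b) id); first exact: derivable_cst.
exact: derivable_id.
Qed.

(** The point is the radius of the disc, which is larger than 1. *)
Lemma holomorphic_szego (c z : C) : nm z < 1 ->
  holomorphic (2 / (1 + nm z)) (fun w => c / (1 - cj z * w)).
Proof.
move=> z1 w wz; apply: (@derivableM C C^o (cst c)); first exact: derivable_cst.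
apply: (@derivableV C C^o (fun w => 1 - cj z * w)).
  rewrite subr_eq0; apply/eqP => /(congr1 nm); rewrite nmM nm_conj Normc.normc1.
  have z0 := nm_ge0 z; have : nm w * (1 + nm z) < 2 by rewrite -ltr_pdivlMr// ltr_wpDr.
  rewrite mulrDr mulr1 [nm w * _]mulrC => + h; rewrite -h => w1.
  have : nm z * nm w <= nm z by rewrite ler_piMr//; clear -w1; lra.
  by rewrite -h; clear -z1; lra.
by under eq_fun do rewrite -mulNr; exact: derivable_aff.
Qed.

Lemma rho_gt1 (z : C) : nm z < 1 -> 1 < 2 / (1 + nm z).
Proof.
move=> z1; have z0 := nm_ge0 z.
have p : 0 < 1 + nm z by clear -z0; lra.
by rewrite ltr_pdivlMr// mul1r; clear -z1; lra.
Qed.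

Lemma kernel_conj (z : C) s : nm z < 1 ->
  cauchy_kernel z s = cj (1 / (1 - cj z * cis s)).
Proof.
move=> z1; rewrite /cauchy_kernel !mul1r conjc_inv cconjB cconjM conjcK conjc1.
rewrite -cisV -[1 - z / _](@mulfK _ (cis s)) ?cis_neq0//.
by rewrite mulrBl mul1r divfK ?cis_neq0// invfM invrK mulrC.
Qed.

(** The kernel is the conjugate of the Szego kernel 1 / (1 - z^* w), which is
    analytic beyond the circle, so that its mean is its value 1 at the origin. *)
Lemma cintegral_kernel (z : C) : nm z < 1 -> cintegral (cauchy_kernel z) = 1.
Proof.
move=> z1; have n0 : nm 0 < 1 by rewrite nm0.
have hz := @holomorphic_szego 1 z z1.
have := cintegral_kernel_mean (rho_gt1 z1) hz n0.
have k0 (s : R) : cauchy_kernel 0 s = 1 by rewrite /cauchy_kernel subr0 divff ?cis_neq0.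
have -> : cintegral (cauchy_kernel (0 : C)) = 1.
  by transitivity (cintegral (fun=> 1 : C)); [exact: eq_cintegral|exact: cintegral_cst].
rewrite mulr0 subr0 !mulr1 divr1 => h.
have -> : cintegral (cauchy_kernel z) =
    cintegral (fun s => cj (1 / (1 - cj z * cis s) * cauchy_kernel 0 s)).
  by apply: eq_cintegral => s; rewrite k0 mulr1 -kernel_conj.
rewrite cintegral_conj ?h ?conjc1//; apply: ccontinuous_integrable.
by apply: ccontinuousM; [exact: (holomorphic_ccontinuous (rho_gt1 z1) hz)|
  exact: ccontinuous_kernel].
Qed.

Theorem cauchy_formula (rho : R) (f : C -> C) (z : C) :
  1 < rho -> holomorphic rho f -> nm z < 1 ->
  f z = cintegral (fun s => f (cis s) * cauchy_kernel z s).
Proof.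
by move=> rho1 fh z1; rewrite (cintegral_kernel_mean rho1 fh)// cintegral_kernel// mulr1.
Qed.

Definition poisson_kernel (z : C) (s : R) : R :=
  (1 - nm z ^+ 2) / nm (cis s - z) ^+ 2.

Lemma poisson_kernelE z s : nm z < 1 ->
  (poisson_kernel z s)%:C = (1 - nm z ^+ 2)%:C / (1 - cj z * cis s) * cauchy_kernel z s.
Proof.
move=> z1; have n0 : 1 - cj z * cis s = cis s * cj (cis s - z).
  by rewrite cconjB -cisV mulrBr divff ?cis_neq0// mulrC.
rewrite n0 /cauchy_kernel /poisson_kernel rmorphM /= fmorphV/= -mulJ_nm.
have h1 := cis_subz_neq0 s z1; have h2 := cis_neq0 s.
have h3 : cj (cis s - z) != 0 by rewrite conjc_eq0.
move: h1 h2 h3; set u := cis s - z; set v := cj u; set w := cis s => h1 h2 h3.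
by field; rewrite h1 h2 h3.
Qed.

(** Cauchy's formula for f(w) (1 - |z|^2) / (1 - z^* w), a function that agrees
    with f at w = z and turns the Cauchy kernel into the Poisson kernel. *)
Theorem poisson_formula (rho : R) (f : C -> C) (z : C) :
  1 < rho -> holomorphic rho f -> nm z < 1 ->
  f z = cintegral (fun s => (poisson_kernel z s)%:C * f (cis s)).
Proof.
move=> rho1 fh z1.
pose c : C := (1 - nm z ^+ 2)%:C.
pose k w := f w * (c / (1 - cj z * w)).
have rz := rho_gt1 z1.
have kh : holomorphic (Num.min rho (2 / (1 + nm z))) k.
  move=> w; rewrite lt_min => /andP[w1 w2].
  apply: (@derivableM C C^o f); first exact: fh.
  exact: (@holomorphic_szego c z z1).
have r1 : 1 < Num.min rho (2 / (1 + nm z)) by rewrite lt_min rho1.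
have := cauchy_formula r1 kh z1.
have -> : k z = f z.
  have cE : 1 - cj z * z = c by rewrite mulrC mulJ_nm /c rmorphB rmorph1.
  rewrite /k cE divff ?mulr1//.
  by rewrite eq_complex/= eqxx andbT subr_eq0 gt_eqF// expr_lt1 ?nm_ge0.
move=> ->; apply: eq_cintegral => s.
by rewrite poisson_kernelE// /k; ring.
Qed.

Lemma poisson_kernel_ge0 z s : nm z < 1 -> 0 <= poisson_kernel z s.
Proof.
move=> z1; rewrite divr_ge0 ?exprn_ge0 ?nm_ge0// subr_ge0.
by rewrite expr_le1 ?nm_ge0// ltW.
Qed.

Lemma poisson_kernel_le z s : nm z < 1 ->
  poisson_kernel z s <= (1 - nm z) ^- 2.
Proof.
move=> z1; have z0 := nm_ge0 z.
apply: (@le_trans _ _ (nm (cis s - z) ^- 2)).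
  rewrite ler_piMl ?invr_ge0 ?exprn_ge0 ?nm_ge0//.
  by rewrite gerBl exprn_ge0.
have h := cis_subz s z1.
have h0 : 0 < 1 - nm z by rewrite subr_gt0.
rewrite lef_pV2 ?posrE ?exprn_gt0 ?nm_gt0 ?cis_subz_neq0//.
by rewrite ler_pXn2r// ?nnegrE ?nm_ge0 ?ltW.
Qed.

Lemma continuous_poisson_kernel z s : nm z < 1 ->
  poisson_kernel z t @[t --> s] --> poisson_kernel z s.
Proof.
move=> z1; have : (fun t => (1 - nm z ^+ 2)%:C / (1 - cj z * cis t) * cauchy_kernel z t)
    @ s --> ((1 - nm z ^+ 2)%:C / (1 - cj z * cis s) * cauchy_kernel z s : C^o).
  apply: ccontinuousM; last exact: ccontinuous_kernel.
  exact: (holomorphic_ccontinuous (rho_gt1 z1) (@holomorphic_szego _ z z1)).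
move=> /cvgC_ReIm[+ _]; rewrite -poisson_kernelE//=.
by under eq_cvg do rewrite -poisson_kernelE//=.
Qed.

(** The Poisson formula for the constant function 1. *)
Lemma integral_poisson_kernel z : nm z < 1 ->
  \int[m]_s poisson_kernel z s = 1.
Proof.
move=> z1; have h : holomorphic 2 (cst 1 : C -> C) by move=> w _; exact: derivable_cst.
have r2 : 1 < 2 :> R by rewrite ltr1n.
rewrite -[RHS]/(Re ((cst 1 : C -> C) z)) (poisson_formula r2 h z1) /cintegral /=.
by apply: eq_Rintegral => s _; rewrite mulr1 mul0r subr0.
Qed.

Lemma poisson_kernel0 t : poisson_kernel 0 t = 1.
Proof. by rewrite /poisson_kernel nm0 subr0 nm_cis expr0n subr0 expr1n divr1. Qed.

End Poisson.

(** * Matrix norms and positive definite matrices *)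

Section MatrixNorms.
Variable R : realType.
Local Notation C := R[i].
Local Notation cj := (@conjc R).
Local Notation nm := (@Normc.normc R).
Local Notation Re := (@complex.Re R).

(** Lagrange's identity: twice the defect is the sum of the squares of
    a_i b_j - a_j b_i. *)
Lemma cauchy_schwarz_real n (a b : 'I_n -> R) :
  (\sum_i a i * b i) ^+ 2 <= (\sum_i a i ^+ 2) * (\sum_i b i ^+ 2).
Proof.
rewrite -subr_ge0 -(@pmulr_rge0 _ 2)//.
suff -> : 2 * ((\sum_i a i ^+ 2) * (\sum_i b i ^+ 2) - (\sum_i a i * b i) ^+ 2) =
    \sum_i \sum_j (a i * b j - a j * b i) ^+ 2.
  by apply: sumr_ge0 => i _; apply: sumr_ge0 => j _; exact: sqr_ge0.
have -> : \sum_i \sum_j (a i * b j - a j * b i) ^+ 2 =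
    \sum_i \sum_j (a i ^+ 2 * b j ^+ 2) + \sum_i \sum_j (b i ^+ 2 * a j ^+ 2)
    - 2 * \sum_i \sum_j ((a i * b i) * (a j * b j)).
  rewrite mulr_sumr -big_split/= -sumrB; apply: eq_bigr => i _.
  rewrite mulr_sumr -big_split/= -sumrB; apply: eq_bigr => j _; ring.
rewrite -!big_distrlr/=; ring.
Qed.

Definition frob2 m n (M : 'M[C]_(m, n)) : R := \sum_i \sum_j nm (M i j) ^+ 2.

Lemma frob2_ge0 m n (M : 'M[C]_(m, n)) : 0 <= frob2 M.
Proof. by apply: sumr_ge0 => i _; apply: sumr_ge0 => j _; exact: sqr_ge0. Qed.

Lemma frob2_eq0 m n (M : 'M[C]_(m, n)) : (frob2 M == 0) = (M == 0).
Proof.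
apply/eqP/eqP => [|->]; last first.
  by rewrite /frob2 big1// => i _; rewrite big1// => j _; rewrite mxE nm0 expr0n.
move=> /eqP; rewrite psumr_eq0; last first.
  by move=> i _; apply: sumr_ge0 => j _; exact: sqr_ge0.
move=> /allP h; apply/matrixP => i j; rewrite mxE.
have := h i (mem_index_enum _); rewrite psumr_eq0; last by move=> *; exact: sqr_ge0.
by move=> /allP/(_ j (mem_index_enum _)); rewrite sqrf_eq0 nm_eq0 => /eqP.
Qed.

Lemma nm_sum (I : Type) (s : seq I) (F : I -> C) :
  nm (\sum_(i <- s) F i) <= \sum_(i <- s) nm (F i).
Proof.
elim: s => [|i s ih]; first by rewrite !big_nil nm0.
by rewrite !big_cons (le_trans (nmD _ _))// lerD2l.
Qed.

Lemma cauchy_schwarz_complex n (a b : 'I_n -> C) :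
  nm (\sum_i a i * b i) ^+ 2 <= (\sum_i nm (a i) ^+ 2) * (\sum_i nm (b i) ^+ 2).
Proof.
apply: le_trans (cauchy_schwarz_real _ _); apply: lerXn2r.
- by rewrite nnegrE nm_ge0.
- by rewrite nnegrE; apply: sumr_ge0 => i _; rewrite mulr_ge0 ?nm_ge0.
by apply: le_trans (nm_sum _ _) _; apply: ler_sum => i _; rewrite nmM.
Qed.

Lemma conj_cj (z : C) : Num.conj z = cj z. Proof. by []. Qed.

Lemma frob2_adj m n (M : 'M[C]_(m, n)) : frob2 (M^t*) = frob2 M.
Proof.
rewrite /frob2 exchange_big/=; apply: eq_bigr => i _; apply: eq_bigr => j _.
by rewrite !mxE conj_cj nm_conj.
Qed.

Lemma frob2M m n p (A : 'M[C]_(m, n)) (B : 'M[C]_(n, p)) :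
  frob2 (A *m B) <= frob2 A * frob2 B.
Proof.
rewrite {2}/frob2 mulr_suml; apply: ler_sum => i _.
rewrite -frob2_adj /frob2 mulr_sumr; apply: ler_sum => j _.
rewrite mxE; apply: le_trans (cauchy_schwarz_complex _ _) _.
rewrite le_eqVlt; apply/orP; left; apply/eqP; congr (_ * _).
by apply: eq_bigr => k _; rewrite !mxE conj_cj nm_conj.
Qed.

Lemma adjM m n p (A : 'M[C]_(m, n)) (B : 'M[C]_(n, p)) :
  (A *m B)^t* = B^t* *m A^t*.
Proof. by rewrite trmx_mul map_mxM. Qed.

Lemma adjK m n (M : 'M[C]_(m, n)) : (M^t*)^t* = M.
Proof. exact: trmxCK. Qed.

Lemma trace_adj n (M : 'M[C]_n) : \tr (M^t*) = cj (\tr M).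
Proof.
rewrite /mxtrace (raddf_sum (@conjc R)); apply: eq_bigr => i _.
by rewrite !mxE.
Qed.

Lemma frob2_tr m n (M : 'M[C]_(m, n)) : \tr (M *m M^t*) = (frob2 M)%:C.
Proof.
rewrite /frob2 rmorph_sum/=; apply: eq_bigr => i _; rewrite mxE rmorph_sum/=.
by apply: eq_bigr => j _; rewrite !mxE conj_cj mulJ_nm.
Qed.

Lemma frob2_cv n (x : 'cV[C]_n) : (x^t* *m x) 0 0 = (frob2 x)%:C.
Proof.
rewrite -frob2_adj -frob2_tr trmxCK.
by rewrite /mxtrace big_ord1.
Qed.

Lemma cvnormE n (x : 'cV[C]_n) : cvnorm x = Num.sqrt (frob2 x).
Proof. by congr Num.sqrt; apply: eq_bigr => i _; rewrite big_ord1. Qed.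

Lemma cvnorm_ge0 n (x : 'cV[C]_n) : 0 <= cvnorm x.
Proof. by rewrite cvnormE sqrtr_ge0. Qed.

Lemma sqr_cvnorm n (x : 'cV[C]_n) : cvnorm x ^+ 2 = frob2 x.
Proof. by rewrite cvnormE sqr_sqrtr// frob2_ge0. Qed.

Lemma frob2Z m n (c : C) (M : 'M[C]_(m, n)) : frob2 (c *: M) = nm c ^+ 2 * frob2 M.
Proof.
rewrite /frob2 mulr_sumr; apply: eq_bigr => i _; rewrite mulr_sumr.
by apply: eq_bigr => j _; rewrite mxE nmM exprMn.
Qed.

Lemma cvnormZ n (c : C) (x : 'cV[C]_n) : cvnorm (c *: x) = nm c * cvnorm x.
Proof. by rewrite !cvnormE frob2Z sqrtrM ?sqr_ge0// sqrtr_sqr ger0_norm// nm_ge0. Qed.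

Lemma cvnorm0 n : cvnorm (0 : 'cV[C]_n) = 0.
Proof.
by rewrite cvnormE (_ : frob2 0 = 0) ?sqrtr0//; apply/eqP; rewrite frob2_eq0.
Qed.

Lemma opnorm_has_ubound n (M : 'M[C]_n) : ubound
  [set cvnorm (M *m x) | x in [set x : 'cV[C]_n | cvnorm x <= 1]] (Num.sqrt (frob2 M)).
Proof.
move=> _ [x /= x1 <-]; rewrite cvnormE ler_wsqrtr//.
apply: le_trans (frob2M _ _) _; rewrite ler_piMr ?frob2_ge0//.
by rewrite -sqr_cvnorm expr_le1// cvnorm_ge0.
Qed.

Lemma opnorm_nonempty n (M : 'M[C]_n) :
  [set cvnorm (M *m x) | x in [set x : 'cV[C]_n | cvnorm x <= 1]] (0 : R).
Proof.
by exists 0; rewrite /= ?mulmx0 cvnorm0.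
Qed.

Lemma opnorm_ge0 n (M : 'M[C]_n) : 0 <= opnorm M.
Proof.
apply: ub_le_sup; last exact: opnorm_nonempty.
by exists (Num.sqrt (frob2 M)); exact: opnorm_has_ubound.
Qed.

Lemma sqr_opnorm_le n (M : 'M[C]_n) : opnorm M ^+ 2 <= frob2 M.
Proof.
rewrite -[leRHS]sqr_sqrtr ?frob2_ge0// ler_pXn2r ?nnegrE ?opnorm_ge0 ?sqrtr_ge0//.
apply: ge_sup; [by exists 0; exact: opnorm_nonempty|exact: opnorm_has_ubound].
Qed.

Lemma cvnorm_mulmx n (M : 'M[C]_n) (x : 'cV[C]_n) :
  cvnorm (M *m x) <= opnorm M * cvnorm x.
Proof.
have [x0|x0] := eqVneq (cvnorm x) 0.
  have /eqP -> : x == 0 by rewrite -frob2_eq0 -sqr_cvnorm x0 expr0n.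
  by rewrite mulmx0 cvnorm0 mulr0.
have xp : 0 < cvnorm x by rewrite lt0r x0 cvnorm_ge0.
rewrite -ler_pdivrMr//.
apply: ub_le_sup; first by exists (Num.sqrt (frob2 M)); exact: opnorm_has_ubound.
exists ((cvnorm x)^-1%:C *: x).
  by rewrite /= cvnormZ nmC ger0_norm ?invr_ge0 ?cvnorm_ge0// mulVf.
by rewrite -scalemxAr cvnormZ nmC ger0_norm ?invr_ge0 ?cvnorm_ge0// mulrC.
Qed.

Lemma dot_le n (x y : 'cV[C]_n) : nm ((x^t* *m y) 0 0) <= cvnorm x * cvnorm y.
Proof.
rewrite -(@ler_pXn2r _ 2)// ?nnegrE ?mulr_ge0 ?nm_ge0 ?cvnorm_ge0//.
rewrite exprMn !sqr_cvnorm mxE; apply: le_trans (cauchy_schwarz_complex _ _) _.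
rewrite le_eqVlt; apply/orP; left; apply/eqP; congr (_ * _).
  by apply: eq_bigr => k _; rewrite big_ord1 !mxE conj_cj nm_conj.
by apply: eq_bigr => k _; rewrite big_ord1.
Qed.

Lemma quadratic_le n (M : 'M[C]_n) (x : 'cV[C]_n) :
  nm ((x^t* *m M *m x) 0 0) <= opnorm M * frob2 x.
Proof.
rewrite -mulmxA; apply: le_trans (dot_le _ _) _.
rewrite -sqr_cvnorm expr2 mulrCA ler_wpM2l ?cvnorm_ge0//.
exact: cvnorm_mulmx.
Qed.

(** One half of |A|^2 = |A A^*|: for x = A y one has |x|^2 = <A^* x, y>, while
    |A^* x|^2 = <A A^* x, x> is at most |A A^*| |x|^2. *)
Lemma frob2_factor_cv n (A : 'M[C]_n) (y : 'cV[C]_n) :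
  frob2 (A *m y) <= opnorm (A *m A^t*) * frob2 y.
Proof.
have h2 (x : 'cV[C]_n) : frob2 (A^t* *m x) <= opnorm (A *m A^t*) * frob2 x.
  have := quadratic_le (A *m A^t*) x.
  have -> : x^t* *m (A *m A^t*) *m x = (A^t* *m x)^t* *m (A^t* *m x).
    by rewrite adjM adjK !mulmxA.
  by rewrite frob2_cv nmC ger0_norm// frob2_ge0.
have h1 (x : 'cV[C]_n) : x = A *m y -> frob2 x <= cvnorm (A^t* *m x) * cvnorm y.
  move=> xE; have := dot_le (A^t* *m x) y; rewrite adjM adjK -mulmxA -xE frob2_cv nmC.
  by rewrite ger0_norm// frob2_ge0.
have {}h1 := h1 _ erefl; have {}h2 := h2 (A *m y).
move: h1 h2; move: (A *m y) => x h1 h2.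
have [x0|x0] := eqVneq (frob2 x) 0.
  by rewrite x0 mulr_ge0 ?opnorm_ge0 ?frob2_ge0.
have xp : 0 < frob2 x by rewrite lt0r x0 frob2_ge0.
rewrite -(ler_pM2l xp) -expr2.
apply: (@le_trans _ _ ((cvnorm (A^t* *m x) * cvnorm y) ^+ 2)).
  by rewrite ler_pXn2r ?nnegrE ?mulr_ge0 ?cvnorm_ge0 ?frob2_ge0.
rewrite exprMn !sqr_cvnorm mulrA [frob2 x * _]mulrC.
by rewrite ler_wpM2r ?frob2_ge0.
Qed.

Lemma frob2_col m n (M : 'M[C]_(m, n)) : frob2 M = \sum_j frob2 (col j M).
Proof.
rewrite /frob2 exchange_big/=; apply: eq_bigr => j _; apply: eq_bigr => i _.
by rewrite big_ord1 mxE.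
Qed.

Lemma frob2_factor n p (A : 'M[C]_n) (Y : 'M[C]_(n, p)) :
  frob2 (A *m Y) <= opnorm (A *m A^t*) * frob2 Y.
Proof.
rewrite frob2_col [in leRHS]frob2_col mulr_sumr; apply: ler_sum => j _.
have -> : col j (A *m Y) = A *m col j Y.
  by apply/matrixP => i k; rewrite !mxE; apply: eq_bigr => l _; rewrite !mxE.
exact: frob2_factor_cv.
Qed.

Lemma Re_sum (I : Type) (s : seq I) (F : I -> C) :
  Re (\sum_(i <- s) F i) = \sum_(i <- s) Re (F i).
Proof. by elim: s => [|i s ih]; rewrite ?big_nil// !big_cons cReD ih. Qed.

(** The trace is the sum of the quadratic form of H at the columns of B^*, whose
    squared norms add up to frob2 B. *)
Lemma trace_conj_le n (B H : 'M[C]_n) :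
  Re (\tr (B *m H *m B^t*)) <= opnorm H * frob2 B.
Proof.
rewrite /mxtrace Re_sum -[frob2 B]frob2_adj frob2_col mulr_sumr.
apply: ler_sum => i _.
apply: le_trans (le_trans (ler_norm _) (Re_le_nm _)) _.
have -> : (B *m H *m B^t*) i i = ((col i (B^t*))^t* *m H *m col i (B^t*)) 0 0.
  rewrite mxE [in RHS]mxE; apply: eq_bigr => k _; rewrite !mxE; congr (_ * _).
  by apply: eq_bigr => l _; rewrite !mxE conjCK.
exact: quadratic_le.
Qed.

Lemma posdef_adj n (A : 'M[C]_n) : posdefmx A -> A^t* = A.
Proof.
by move=> [/is_hermitianmxP h _]; rewrite [RHS]h expr0 scale1r.
Qed.

Lemma posdefP n (A : 'M[C]_n) : A^t* = A ->
  (forall x : 'cV[C]_n, x != 0 -> 0 < (x^t* *m A *m x) 0 0) -> posdefmx A.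
Proof.
by move=> h p; split=> //; apply/is_hermitianmxP; rewrite expr0 scale1r h.
Qed.

(** The eigenvalues are the values of the quadratic form at unit eigenvectors,
    which makes them positive and at most the operator norm. *)
Lemma posdef_spectral n (A : 'M[C]_n) : posdefmx A ->
  exists (P : 'M[C]_n) (d : 'I_n -> R),
    [/\ P *m P^t* = 1%:M, P^t* *m P = 1%:M,
        forall i, 0 < d i, forall i, d i <= opnorm A &
        A = P^t* *m diag_mx (\row_i (d i)%:C) *m P].
Proof.
move=> [Ah Apos].
have [P [sp [Pu AE]]] : exists (P : 'M[C]_n) (sp : 'rV[C]_n),
    P \is unitarymx /\ A = P^t* *m diag_mx sp *m P.
  exists (spectralmx A), (spectral_diag A); split; first exact: spectral_unitarymx.
  rewrite -invmx_unitary ?spectral_unitarymx//.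
  exact/orthomx_spectralP/hermitian_normalmx.
have PP : P *m P^t* = 1%:M by exact/unitarymxP.
have PP' : P^t* *m P = 1%:M by exact: mulmx1C.
pose x i : 'cV[C]_n := P^t* *m delta_mx i 0.
have Px i : P *m x i = delta_mx i 0 by rewrite mulmxA PP mul1mx.
have xx i : frob2 (x i) = 1.
  apply: complexI; rewrite -frob2_cv /x adjM adjK mulmxA -(mulmxA _ P) PP mulmx1.
  rewrite frob2_cv; congr (_%:C); rewrite /frob2 (bigD1 i)//= big_ord1 mxE !eqxx.
  rewrite Normc.normc1 expr1n big1 ?addr0// => j ji.
  by rewrite big_ord1 mxE (negPf ji) nm0 expr0n.
have xAx i : ((x i)^t* *m A *m x i) 0 0 = sp 0 i.
  have -> : (x i)^t* *m A *m x i = (P *m x i)^t* *m diag_mx sp *m (P *m x i).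
    by rewrite AE adjM !mulmxA.
  by rewrite Px trmx_delta map_delta_mx -rowE -colE !mxE eqxx mulr1n.
have spos i : 0 < sp 0 i.
  by rewrite -xAx; apply: Apos; rewrite -frob2_eq0 xx oner_eq0.
exists P, (fun i => Re (sp 0 i)); split; [exact: PP|exact: PP'|..].
- by move=> i; have := spos i; rewrite ltcE/= => /andP[].
- move=> i; have := quadratic_le A (x i); rewrite xAx xx mulr1; apply: le_trans.
  exact: le_trans (ler_norm _) (Re_le_nm _).
- suff -> : \row_i (Re (sp 0 i))%:C = sp by exact: AE.
  by apply/rowP => i; rewrite mxE RRe_real// gtr0_real.
Qed.

Section Posdef.
Variables (n : nat) (A : 'M[C]_n).
Hypothesis pA : posdefmx A.

Lemma spectral_inv (P : 'M[C]_n) (d : 'I_n -> R) :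
  P *m P^t* = 1%:M -> P^t* *m P = 1%:M -> (forall i, 0 < d i) ->
  A = P^t* *m diag_mx (\row_i (d i)%:C) *m P ->
  P^t* *m diag_mx (\row_i (d i)^-1%:C) *m P *m A = 1%:M.
Proof.
move=> PP PP' d0 ->; rewrite !mulmxA -(mulmxA _ P) PP mulmx1 -(mulmxA (P^t*)).
rewrite mulmx_diag (_ : \row__ _ = const_mx 1) ?diag_const_mx ?mulmx1//.
by apply/rowP => i; rewrite !mxE -rmorphM/= mulVf// gt_eqF.
Qed.

Lemma spectral_det (P : 'M[C]_n) (d : 'I_n -> R) :
  P^t* *m P = 1%:M -> A = P^t* *m diag_mx (\row_i (d i)%:C) *m P ->
  \det A = (\prod_i d i)%:C.
Proof.
move=> PP' ->; rewrite !det_mulmx mulrAC -det_mulmx PP' det1 mul1r det_diag.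
by rewrite rmorph_prod; apply: eq_bigr => i _; rewrite mxE.
Qed.

Lemma posdef_det : 0 < Re (\det A) /\ \det A = (Re (\det A))%:C.
Proof.
have [P [d [PP PP' d0 _ AE]]] := posdef_spectral pA.
by rewrite (spectral_det PP' AE)/=; split=> //; exact: prodr_gt0.
Qed.

Lemma posdef_unit : A \in unitmx.
Proof.
have [d0 dE] := posdef_det; rewrite unitmxE unitfE dE.
by apply/eqP => -[/eqP]; rewrite gt_eqF.
Qed.

(** The left-hand side is the trace of A^{-1}, and each eigenvalue of A is at
    least det A / max(1, |A|)^(n-1). *)
Lemma frob2_inv_factor (S : 'M[C]_n) : A = S *m S^t* ->
  frob2 (invmx S) <= n%:R * expR (n%:R * logplus (opnorm A) - logdet A).
Proof.
move=> AS; have [P [d [PP PP' d0 dA AE]]] := posdef_spectral pA.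
have dE := spectral_det PP' AE.
have S_unit : S \in unitmx.
  by have := posdef_unit; rewrite AS unitmx_mul => /andP[].
pose X := P^t* *m diag_mx (\row_i (d i)^-1%:C) *m P.
have XA : X *m A = 1%:M by exact: spectral_inv.
have BE : (invmx S)^t* *m invmx S = X.
  have BA : (invmx S)^t* *m invmx S *m A = 1%:M.
    rewrite AS !mulmxA mulmxKV// -adjM mulmxV// trmx1 map_mx1//.
  by rewrite -[LHS]mulmx1 -(mulmx1C XA) mulmxA BA mul1mx.
have -> : frob2 (invmx S) = \sum_i (d i)^-1.
  apply: complexI; rewrite -frob2_adj -frob2_tr adjK BE /X.
  rewrite mxtrace_mulC mulmxA PP mul1mx mxtrace_diag rmorph_sum.
  by apply: eq_bigr => i _; rewrite mxE.
have -> : n%:R * expR (n%:R * logplus (opnorm A) - logdet A) =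
    \sum_(i < n) expR (n%:R * logplus (opnorm A) - logdet A).
  by rewrite sumr_const card_ord mulr_natl.
apply: ler_sum => i _.
have ldE : logdet A = ln (\prod_i d i) by rewrite /logdet dE.
have D0 : 0 < \prod_i d i by exact: prodr_gt0.
have l0 : 0 <= logplus (opnorm A) by rewrite /logplus le_max lexx.
rewrite expRB ldE lnK ?posrE//.
have -> : (d i)^-1 = (\prod_(j | j != i) d j) / \prod_j d j.
  rewrite [X in _ / X](bigD1 i)//= invfM mulrCA mulfV ?mulr1//.
  by rewrite gt_eqF// prodr_gt0.
rewrite ler_pM2r ?invr_gt0//.
have le1 : \prod_(j | j != i) d j <= \prod_(j | j != i) expR (logplus (opnorm A)).
  apply: ler_prod => j _; rewrite (ltW (d0 j))/=; apply: le_trans (dA j) _.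
  have A0 : 0 < opnorm A by exact: lt_le_trans (d0 j) (dA j).
  by rewrite -[leLHS]lnK ?posrE// ler_expR le_max lexx orbT.
apply: le_trans le1 _; rewrite prodr_const expRM_natl.
rewrite ler_weXn2l// -?expR0 ?ler_expR//.
by rewrite (leq_trans (max_card _))// card_ord.
Qed.

End Posdef.

Lemma ln_prod n (d : 'I_n -> R) : (forall i, 0 < d i) ->
  ln (\prod_i d i) = \sum_i ln (d i).
Proof.
move=> d0; apply: (big_ind2 (fun x y => 0 < x /\ ln x = y) _ _ _).2 => //.
- by rewrite ln1.
- by move=> x1 y1 x2 y2 [x10 <-] [x20 <-]; rewrite lnM// mulr_gt0.
Qed.

Lemma posdef_inv_sqrt n (A : 'M[C]_n) : posdefmx A ->
  exists S : 'M[C]_n, S *m S^t* = invmx A.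
Proof.
move=> pA; have [P [d [PP PP' d0 _ AE]]] := posdef_spectral pA.
have XA := spectral_inv PP PP' d0 AE.
pose D := diag_mx (\row_i (Num.sqrt (d i)^-1)%:C) : 'M[C]_n.
have DD : D *m D^t* = diag_mx (\row_i (d i)^-1%:C).
  rewrite /D tr_diag_mx map_diag_mx mulmx_diag; congr diag_mx; apply/rowP => i.
  rewrite !mxE; transitivity ((Num.sqrt (d i)^-1)%:C * (Num.sqrt (d i)^-1)%:C).
    by congr (_ * _); exact: conjc_real.
  by rewrite -rmorphM/= -expr2 sqr_sqrtr// invr_ge0 ltW.
exists (P^t* *m D); rewrite adjM adjK mulmxA -(mulmxA _ D) DD.
move: XA; set X := P^t* *m _ *m P => XA.
by rewrite -[invmx A]mul1mx -XA mulmxK// posdef_unit.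
Qed.

(** The inequality of the arithmetic and geometric means for the eigenvalues
    of A^{-1} B, in the form ln x <= x - 1. *)
Lemma trace_ge_logdet n (A B : 'M[C]_n) : posdefmx A -> posdefmx B ->
  n%:R + (logdet B - logdet A) <= Re (\tr (invmx A *m B)).
Proof.
move=> pA pB; have [S SS] := posdef_inv_sqrt pA.
have A_unit := posdef_unit pA.
have S_unit : S \in unitmx.
  have : S *m S^t* \in unitmx by rewrite SS unitmx_inv.
  by rewrite unitmx_mul => /andP[].
pose H := S^t* *m B *m S.
have pH : posdefmx H.
  apply: posdefP; first by rewrite /H !adjM adjK (posdef_adj pB) mulmxA.
  move=> x x0; have -> : x^t* *m H *m x = (S *m x)^t* *m B *m (S *m x).
    by rewrite /H adjM !mulmxA.
  apply: pB.2; apply: contra x0 => /eqP Sx.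
  by rewrite -[x](mulKmx S_unit) Sx mulmx0.
have -> : \tr (invmx A *m B) = \tr H.
  by rewrite -SS -mulmxA mxtrace_mulC /H.
have dHE : \det H = \det B / \det A.
  rewrite /H !det_mulmx mulrAC mulrC -det_mulmx.
  have -> : \det (S^t* *m S) = \det (S *m S^t*) by rewrite !det_mulmx mulrC.
  by rewrite SS det_inv.
have [dA0 dA] := posdef_det pA; have [dB0 dB] := posdef_det pB.
have -> : logdet B - logdet A = logdet H.
  rewrite /logdet -ln_div ?posrE// dHE {2}dA {2}dB -fmorph_div/=.
  by [].
have [Q [e [QQ QQ' e0 _ HE]]] := posdef_spectral pH.
rewrite /logdet (spectral_det QQ' HE) /= ln_prod//.
have -> : \tr H = (\sum_i e i)%:C.
  rewrite {1}HE mxtrace_mulC mulmxA QQ mul1mx mxtrace_diag rmorph_sum.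
  by apply: eq_bigr => i _; rewrite mxE.
have -> : n%:R + \sum_i ln (e i) = \sum_(i < n) (1 + ln (e i)).
  by rewrite big_split/= sumr_const card_ord.
apply: ler_sum => i _ /=.
have e1 : -1 < e i - 1 by rewrite ltrBrDr addNr.
have := le_ln1Dx e1; have -> : 1 + (e i - 1) = e i by ring.
by clear; lra.
Qed.

(** With F = S S^*, the distance between two factors is governed by that of
    the quotient S^{-1} T from the identity in the Hilbert-Schmidt norm. *)
Lemma sqr_opnorm_sub_le n (S T : 'M[C]_n) : S \in unitmx ->
  opnorm (T - S) ^+ 2 <= opnorm (S *m S^t*) * frob2 (invmx S *m T - 1%:M).
Proof.
move=> S_unit; apply: le_trans (sqr_opnorm_le _) _.
have -> : T - S = S *m (invmx S *m T - 1%:M).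
  by rewrite mulmxBr mulmx1 mulmxA mulmxV// mul1mx.
exact: frob2_factor.
Qed.

Lemma Re_nat (k : nat) : Re (k%:R : C) = k%:R.
Proof. by rewrite -(rmorph_nat (real_complex R)). Qed.

Lemma frob2_sub1 n (X : 'M[C]_n) :
  frob2 (X - 1%:M) = frob2 X + n%:R - 2 * Re (\tr X).
Proof.
have E m p (M : 'M[C]_(m, p)) : frob2 M = Re (\tr (M *m M^t*)) by rewrite frob2_tr.
rewrite !E linearB/= map_mxB trmx1 map_mx1 mulmxBl !mulmxBr mulmx1 !mul1mx.
by rewrite !raddfB/= mxtrace1 trace_adj cRe_conj Re_nat; lra.
Qed.

(** For X = S^{-1} T, conjugating T T^* - S S^* by S^{-1} gives X X^* - 1. *)
Lemma frob2_quotient_le n (S T : 'M[C]_n) : S \in unitmx ->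
  frob2 (invmx S *m T) - n%:R <=
  opnorm (T *m T^t* - S *m S^t*) * frob2 (invmx S).
Proof.
move=> S_unit; apply: le_trans (trace_conj_le _ _).
have -> : invmx S *m (T *m T^t* - S *m S^t*) *m (invmx S)^t* =
    (invmx S *m T) *m (invmx S *m T)^t* - 1%:M.
  rewrite mulmxBr mulmxBl; congr (_ - _); first by rewrite adjM !mulmxA.
  by rewrite mulmxA mulVmx// mul1mx -adjM mulVmx// trmx1 map_mx1.
by rewrite raddfB/= cReB mxtrace1 frob2_tr Re_nat.
Qed.

Lemma sqr_nm_entry m n (M : 'M[C]_(m, n)) i j : nm (M i j) ^+ 2 <= frob2 M.
Proof.
rewrite /frob2 (bigD1 i)//= (bigD1 j)//= -addrA lerDl addr_ge0//.
  by apply: sumr_ge0 => *; exact: sqr_ge0.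
by apply: sumr_ge0 => *; apply: sumr_ge0 => *; exact: sqr_ge0.
Qed.

Lemma nm_sign (b : bool) : nm ((-1) ^+ b) = 1.
Proof. by case: b; rewrite ?expr1 ?expr0 ?nmN Normc.normc1. Qed.

Lemma nm_det_le n (M : 'M[C]_n) (b : R) : (forall i j, nm (M i j) <= b) ->
  nm (\det M) <= (n`!)%:R * b ^+ n.
Proof.
move=> Mb; apply: le_trans (nm_sum _ _) _.
have -> : (n`!)%:R * b ^+ n = \sum_(s : 'S_n) b ^+ n.
  by rewrite sumr_const -card_Sn mulr_natl.
apply: ler_sum => s _; rewrite nmM nm_sign mul1r.
have -> : nm (\prod_i M i (s i)) = \prod_i nm (M i (s i)).
  by apply: (big_morph nm); [exact: nmM|exact: Normc.normc1].
rewrite -[X in b ^+ X]card_ord -prodr_const; apply: ler_prod => i _.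
by rewrite nm_ge0 Mb.
Qed.

Lemma nm_adj_le n (M : 'M[C]_n) (b : R) i j : (forall i j, nm (M i j) <= b) ->
  nm ((\adj M) i j) <= (n.-1)`!%:R * b ^+ n.-1.
Proof.
move=> Mb; rewrite mxE /cofactor nmM -signr_odd nm_sign mul1r.
by apply: nm_det_le => k l; rewrite !mxE.
Qed.

Lemma sqr_nm_trace n (M : 'M[C]_n) : nm (\tr M) ^+ 2 <= n%:R * frob2 M.
Proof.
have := cauchy_schwarz_complex (fun i => M i i) (fun=> 1).
under eq_bigr do rewrite mulr1.
move=> /le_trans; apply; rewrite mulrC; apply: ler_pM.
- by apply: sumr_ge0 => *; exact: sqr_ge0.
- by apply: sumr_ge0 => *; exact: sqr_ge0.
- by under eq_bigr do rewrite Normc.normc1 expr1n; rewrite sumr_const card_ord.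
apply: ler_sum => i _; rewrite (bigD1 i)//= lerDl.
by apply: sumr_ge0 => *; exact: sqr_ge0.
Qed.

End MatrixNorms.

(** * Limits under an L2 bound *)

Section Vitali.
Context d (T : measurableType d) (R : realType) (mu : {measure set T -> \bar R}).
Hypothesis muT : (mu setT < +oo)%E.

Lemma integrable_cstr (r : R) : mu.-integrable setT (EFin \o (fun=> r)).
Proof.
apply: measurable_bounded_integrable => //; exists `|r|; split => // M rM x _.
exact: ltW.
Qed.

Lemma sq_integrable (f : T -> R) (K : R) : measurable_fun setT f ->
  (\int[mu]_x (f x ^+ 2)%:E <= K%:E)%E ->
  mu.-integrable setT (EFin \o (fun x => f x ^+ 2)) /\
  mu.-integrable setT (EFin \o f).
Proof.
move=> mf fK; have i2 : mu.-integrable setT (EFin \o (fun x => f x ^+ 2)).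
  apply/integrableP; split; first exact/measurable_EFinP/measurable_funX.
  apply: le_lt_trans (ltry K); apply: le_trans fK.
  by under eq_integral do rewrite /= ger0_norm ?sqr_ge0//.
split=> //; have := integrableD measurableT (integrable_cstr 1) i2.
apply: le_integrable => //; first exact/measurable_EFinP.
move=> x _ /=; rewrite lee_fin ler_norml.
rewrite ger0_norm; last by rewrite addr_ge0 ?sqr_ge0.
have h1 := sqr_ge0 (f x + 1); have h2 := sqr_ge0 (f x - 1).
by apply/andP; split; nra.
Qed.

(** Fatou's lemma, on the complement of a null set where convergence may fail. *)
Lemma fatou_sq (u : nat -> T -> R) (g : T -> R) (K : R) :
  (forall k, measurable_fun setT (u k)) -> measurable_fun setT g ->
  (forall k, \int[mu]_x (u k x ^+ 2)%:E <= K%:E)%E ->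
  {ae mu, forall x, u k x @[k --> \oo] --> g x} ->
  (\int[mu]_x (g x ^+ 2)%:E <= K%:E)%E.
Proof.
move=> mu_ mg uK [N [mN N0 sN]].
have mD : measurable (~` N) by exact: measurableC.
have mE (f : T -> R) : measurable_fun setT f ->
    measurable_fun setT (fun x => (f x ^+ 2)%:E).
  by move=> mf; exact/measurable_EFinP/measurable_funX.
have neg (f : T -> R) : measurable_fun setT f ->
    (\int[mu]_x (f x ^+ 2)%:E = \int[mu]_(x in ~` N) (f x ^+ 2)%:E)%E.
  move=> mf; rewrite (ge0_negligible_integral mN)//; first by rewrite setTD.
    exact: mE.
  by move=> x _; rewrite lee_fin sqr_ge0.
rewrite neg//.
have F := @fatou _ _ _ mu _ mD (fun k x => (u k x ^+ 2)%:E).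
have -> : (\int[mu]_(x in ~` N) (g x ^+ 2)%:E =
    \int[mu]_(x in ~` N) limn_einf (fun k => (u k x ^+ 2)%:E))%E.
  apply: eq_integral => x; rewrite inE => Nx.
  have ux : u k x @[k --> \oo] --> g x by apply: contrapT => nux; apply/Nx/sN.
  have cu : (u k x ^+ 2)%:E @[k --> \oo] --> (g x ^+ 2)%:E.
    apply: cvg_EFin; first exact: nearW.
    rewrite expr2; under [X in X @ _]eq_fun do rewrite /= expr2.
    exact: cvgM.
  by rewrite (cvg_limn_einf_sup cu).1.
apply: le_trans (F _ _) _.
- by move=> k; exact/measurable_funTS/mE.
- by move=> k x _; rewrite lee_fin sqr_ge0.
rewrite limn_einf_lim; apply: lime_le; first exact: is_cvg_einfs.
near=> k; apply: (@le_trans _ _ (\int[mu]_(x in ~` N) (u k x ^+ 2)%:E)%E).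
  by apply: ereal_inf_lbound; exists k => //=.
by rewrite -neg.
Unshelve. all: by end_near. Qed.

(** An L2 bound makes the sequence uniformly integrable, so that almost
    everywhere convergence can be integrated; the part of |u_k - g| above the
    level M contributes at most 4K/M. *)
Lemma vitali_L2 (u : nat -> T -> R) (g : T -> R) (K : R) :
  (forall k, measurable_fun setT (u k)) -> measurable_fun setT g ->
  (forall k, \int[mu]_x (u k x ^+ 2)%:E <= K%:E)%E ->
  {ae mu, forall x, u k x @[k --> \oo] --> g x} ->
  [/\ forall k, mu.-integrable setT (EFin \o u k),
      mu.-integrable setT (EFin \o g) &
      \int[mu]_x u k x @[k --> \oo] --> \int[mu]_x g x].
Proof.
move=> mu_ mg uK uae; have gK := fatou_sq mu_ mg uK uae.
have iu k := sq_integrable (mu_ k) (uK k).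
have [ig2 ig] := sq_integrable mg gK.
split=> [k||]; [exact: (iu k).2|exact: ig|].
pose D k x := u k x - g x.
have mD k : measurable_fun setT (D k) by apply: measurable_funB.
have iD k : mu.-integrable setT (EFin \o D k).
  exact: (integrableB measurableT (iu k).2 ig).
have R2 (f : T -> R) : mu.-integrable setT (EFin \o (fun x => f x ^+ 2)) ->
    (\int[mu]_x (f x ^+ 2)%:E <= K%:E)%E -> \int[mu]_x (f x ^+ 2) <= K.
  move=> i2 le; rewrite -lee_fin /Rintegral fineK//.
  exact: integrable_fin_num.
have iS k : mu.-integrable setT (EFin \o (fun x => 2 * u k x ^+ 2 + 2 * g x ^+ 2)).
  have := integrableD measurableT (integrableZl measurableT 2 (iu k).1)
    (integrableZl measurableT 2 ig2); congr (_.-integrable _ _).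
have iS_le k : \int[mu]_x (2 * u k x ^+ 2 + 2 * g x ^+ 2) <= 4 * K.
  rewrite RintegralD//; first last.
  - exact: (integrableZl measurableT 2 ig2).
  - exact: (integrableZl measurableT 2 (iu k).1).
  rewrite !RintegralZl//; first last.
  - exact: (iu k).1.
  have := R2 _ (iu k).1 (uK k); have := R2 _ ig2 gK; lra.
have D2 k x : D k x ^+ 2 <= 2 * u k x ^+ 2 + 2 * g x ^+ 2.
  have := sqr_ge0 (u k x + g x); rewrite /D; nra.
have K0 : 0 <= K.
  rewrite -lee_fin; apply: le_trans gK; apply: integral_ge0 => x _.
  by rewrite lee_fin sqr_ge0.
apply/cvgrPdist_lt => e e0.
pose M : R := 8 * (K + 1) / e.
have M0 : 0 < M by rewrite divr_gt0// mulr_gt0// ltr_wpDl.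
pose c k x : R := Num.min `|D k x| M.
have mc k : measurable_fun setT (c k).
  by apply: measurable_minr => //; exact: measurableT_comp.
have c0 k x : 0 <= c k x by rewrite /c le_min normr_ge0 ltW.
have cM k x : c k x <= M by rewrite /c ge_min lexx orbT.
have m1 k : measurable_fun setT (fun x => (c k x)%:E) by exact/measurable_EFinP.
have m2 : measurable_fun setT (cst 0%E : T -> \bar R) by exact: measurable_cst.
have c_cvg : {ae mu, forall x, setT x ->
    (fun k => (c k x)%:E) @ \oo --> (cst 0%E : T -> \bar R) x}.
  apply: filterS uae => x /cvgrPdist_lt ux _; apply: cvg_EFin; first exact: nearW.
  apply/cvgrPdist_lt => r r0; apply: filterS (ux r r0) => k /= uk.
  rewrite sub0r normrN ger0_norm//; apply: le_lt_trans uk.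
  by rewrite distrC /c ge_min lexx.
have c_dom : {ae mu, forall x k, setT x -> (`|(c k x)%:E| <= (EFin \o (fun=> M)) x)%E}.
  by apply/nearW => x k _; rewrite /= lee_fin ger0_norm.
have [_ _] := dominated_convergence measurableT m1 m2 c_cvg (integrable_cstr M) c_dom.
rewrite integral0 => /fine_cvgP[_ /cvgrPdist_lt c_int].
have e20 : 0 < e / 2 by rewrite divr_gt0.
apply: filterS (c_int _ e20) => k.
rewrite sub0r normrN => ck.
have ic : mu.-integrable setT (EFin \o c k).
  apply: le_integrable (integrable_cstr M) => //; first exact/measurable_EFinP.
  by move=> x _ /=; rewrite lee_fin !ger0_norm ?(ltW M0).
rewrite distrC -RintegralB//; last exact: (iu k).2.
apply: le_lt_trans (le_normr_Rintegral measurableT (iD k)) _.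
have iN : mu.-integrable setT (EFin \o (fun x => `|D k x|)).
  exact: integrable_norm.
have iSM : mu.-integrable setT (EFin \o (fun x => M^-1 * (2 * u k x ^+ 2 + 2 * g x ^+ 2))).
  exact: (integrableZl measurableT M^-1 (iS k)).
apply: (@le_lt_trans _ _ (\int[mu]_x (c k x + M^-1 * (2 * u k x ^+ 2 + 2 * g x ^+ 2)))).
  apply: le_Rintegral => //.
    exact: (integrableD measurableT ic iSM).
  move=> x _; rewrite /c; have [_|MD] := leP `|D k x| M.
    by rewrite lerDl mulr_ge0 ?invr_ge0 ?(ltW M0)// addr_ge0// mulr_ge0 ?sqr_ge0.
  apply: (@le_trans _ _ (M^-1 * D k x ^+ 2)).
    rewrite -[in leRHS]real_normK ?num_real// expr2 mulrA ler_peMl//.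
    by rewrite mulrC ler_pdivlMr// mul1r ltW.
  apply: ler_wpDl; first exact: ltW.
  by rewrite ler_wpM2l// invr_ge0 ltW.
rewrite RintegralD// RintegralZl//.
have ck' : \int[mu]_x c k x < e / 2.
  by apply: le_lt_trans ck; rewrite ler_norm.
rewrite (splitr e); apply: ltr_leD => //.
rewrite ler_pdivrMl//; apply: le_trans (iS_le k) _.
rewrite /M; have -> : 8 * (K + 1) / e * (e / 2) = 4 * (K + 1).
  by field; rewrite gt_eqF.
lra.
Unshelve. all: by end_near. Qed.

End Vitali.

(** * Radial boundary values *)

Lemma circle_ae_filter (R : realType) :
  Filter (almost_everywhere (@circle_measure R)).
Proof. exact: ae_filter_ringOfSetsType. Qed.

(* These make the reasoning on filters apply to properties that hold almost
   everywhere on the circle. *)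
#[global] Hint Extern 0 (Filter (nbhs (almost_everywhere _))) =>
  (exact: circle_ae_filter) : typeclass_instances.
#[global] Hint Extern 0 (Filter (almost_everywhere _)) =>
  (exact: circle_ae_filter) : typeclass_instances.

Section Radial.
Variable R : realType.
Local Notation C := R[i].
Local Notation cj := (@conjc R).
Local Notation nm := (@Normc.normc R).
Local Notation Re := (@complex.Re R).
Local Notation Im := (@complex.Im R).
Local Notation m := (@circle_measure R).
Implicit Types f g : C -> C.

Lemma measurable_circle_cst (c : C) : measurable_circle (fun=> c).
Proof. by split; exact: measurable_cst. Qed.

Lemma measurable_circleD f g : measurable_circle f -> measurable_circle g ->
  measurable_circle (fun z => f z + g z).
Proof.
move=> [f1 f2] [g1 g2]; split.
  by under eq_fun do rewrite cReD; exact: measurable_funD.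
by under eq_fun do rewrite cImD; exact: measurable_funD.
Qed.

Lemma measurable_circleM f g : measurable_circle f -> measurable_circle g ->
  measurable_circle (fun z => f z * g z).
Proof.
move=> [f1 f2] [g1 g2]; split.
  under eq_fun do rewrite cReM.
  by apply: measurable_funB; exact: measurable_funM.
under eq_fun do rewrite cImM.
by apply: measurable_funD; exact: measurable_funM.
Qed.

Lemma measurable_circle_conj f : measurable_circle f ->
  measurable_circle (fun z => cj (f z)).
Proof.
move=> [f1 f2]; split; first by under eq_fun do rewrite cRe_conj.
under eq_fun do rewrite cIm_conj; exact: measurable_funN.
Qed.

Lemma measurable_circle_sqr_nm f : measurable_circle f ->
  measurable_fun setT (fun t : R => nm (f (cis t)) ^+ 2).
Proof.
move=> [f1 f2]; under eq_fun do rewrite sqr_nm.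
by apply: measurable_funD; exact: measurable_funX.
Qed.

Lemma measurable_circleV f : measurable_circle f ->
  measurable_circle (fun z => (f z)^-1).
Proof.
move=> mf; have mn := measurable_circle_sqr_nm mf.
have mi : measurable_fun setT (fun t : R => (nm (f (cis t)) ^+ 2)^-1).
  have -> : (fun t : R => (nm (f (cis t)) ^+ 2)^-1) =
      (@powR R ^~ (-1)) \o (fun t : R => nm (f (cis t)) ^+ 2).
    by apply/funext => t /=; rewrite powR_inv1// exprn_ge0// nm_ge0.
  by apply: measurableT_comp => //; exact: measurable_powR.
case: (measurable_circle_conj mf) => c1 c2; split.
  by under eq_fun do rewrite cinvE ReCM; exact: measurable_funM.
by under eq_fun do rewrite cinvE ImCM; exact: measurable_funM.
Qed.

(** Growth conditions are left out, which makes this class a ring, closed under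
    the inversion of functions without zeros in the disc and almost everywhere
    on the circle. *)
Definition radial f : Prop :=
  [/\ holomorphic 1 f, measurable_circle f &
      {ae m, forall t : R, f (r%:C * cis t) @[r --> 1^'-] --> (f (cis t) : C^o)}].

Lemma holomorphic1E f : holomorphic 1 f <-> analytic_disc f.
Proof.
by split => h z; have := h z; rewrite normcC -(ltcR (nm z) 1).
Qed.

Lemma radial_cst (c : C) : radial (fun=> c).
Proof.
split; first by move=> z _; exact: derivable_cst.
  exact: measurable_circle_cst.
by apply: aeW => t; exact: cvgC_cst.
Qed.

Lemma radialD f g : radial f -> radial g -> radial (fun z => f z + g z).
Proof.
move=> [f1 f2 f3] [g1 g2 g3]; split.
- by move=> z z1; apply: (@derivableD C C^o C^o f g); [exact: f1|exact: g1].
- exact: measurable_circleD.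
- by apply: filterS2 f3 g3 => t; exact: cvgCD.
Qed.

Lemma radialM f g : radial f -> radial g -> radial (fun z => f z * g z).
Proof.
move=> [f1 f2 f3] [g1 g2 g3]; split.
- by move=> z z1; apply: (@derivableM C C^o f g); [exact: f1|exact: g1].
- exact: measurable_circleM.
- by apply: filterS2 f3 g3 => t; exact: cvgCM.
Qed.

Lemma radialV f : radial f -> (forall z, nm z < 1 -> f z != 0) ->
  {ae m, forall t : R, f (cis t) != 0} -> radial (fun z => (f z)^-1).
Proof.
move=> [f1 f2 f3] f0 fb0; split.
- by move=> z z1; apply: (@derivableV C C^o f); [exact: f0|exact: f1].
- exact: measurable_circleV.
- by apply: filterS2 fb0 f3 => t; exact: cvgCV.
Qed.

Lemma radial_sum (I : Type) (s : seq I) (F : I -> C -> C) :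
  (forall i, radial (F i)) -> radial (fun z => \sum_(i <- s) F i z).
Proof.
move=> hF; elim: s => [|i s ih].
  by under eq_fun do rewrite big_nil; exact: radial_cst.
by under eq_fun do rewrite big_cons; exact: radialD (hF i) ih.
Qed.

Lemma radial_prod (I : Type) (s : seq I) (F : I -> C -> C) :
  (forall i, radial (F i)) -> radial (fun z => \prod_(i <- s) F i z).
Proof.
move=> hF; elim: s => [|i s ih].
  by under eq_fun do rewrite big_nil; exact: radial_cst.
by under eq_fun do rewrite big_cons; exact: radialM (hF i) ih.
Qed.

Lemma radial_det n (F : C -> 'M[C]_n) :
  (forall i j, radial (fun z => F z i j)) -> radial (fun z => \det (F z)).
Proof.
move=> hF; rewrite /determinant; apply: radial_sum => s.
apply: radialM; first exact: radial_cst.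
exact: radial_prod.
Qed.

Lemma radial_adj n (F : C -> 'M[C]_n) i j :
  (forall i j, radial (fun z => F z i j)) -> radial (fun z => (\adj (F z)) i j).
Proof.
move=> hF; under eq_fun do rewrite mxE /cofactor.
apply: radialM; first exact: radial_cst.
by apply: radial_det => i' j'; under eq_fun do rewrite !mxE; exact: hF.
Qed.

Lemma cvg_sqr_nm (T : Type) (F : set_system T) {FF : Filter F} (g : T -> C) (l : C) :
  g x @[x --> F] --> (l : C^o) -> nm (g x) ^+ 2 @[x --> F] --> nm l ^+ 2.
Proof.
move=> /cvgC_ReIm[gr gi]; rewrite sqr_nm.
have -> : (fun x => nm (g x) ^+ 2) =
    (fun x => Re (g x) * Re (g x) + Im (g x) * Im (g x)).
  by apply/funext => x; rewrite sqr_nm.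
by rewrite !expr2; apply: cvgD; exact: cvgM.
Qed.

Definition L2_means (K : R) f : Prop := forall r : R, 0 <= r < 1 ->
  (\int[m]_t (nm (f (r%:C * cis t)) ^+ 2)%:E <= K%:E)%E.

Lemma hardy2_L2_means f : hardy 2 f -> radial f /\ exists K, L2_means K f.
Proof.
move=> [f1 [K fK] f2 f3]; split; first by split => //; exact/holomorphic1E.
exists K => r r01; apply: le_trans (fK r r01).
rewrite le_eqVlt; apply/orP; left; apply/eqP/eq_integral => t _.
by rewrite powR_mulrn// nm_ge0.
Qed.

Lemma holomorphic_scale (r : R) f : holomorphic 1 f -> 0 <= r < 1 ->
  holomorphic (2 / (1 + r)) (fun w => f (r%:C * w)).
Proof.
move=> fh /andP[r0 r1] w wr.
have dl : differentiable ((fun w => r%:C * w) : C^o -> C^o) (w : C^o).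
  apply/derivable1_diffP; apply: (@derivableM C C^o (cst r%:C) id).
    exact: derivable_cst.
  exact: derivable_id.
suff df : differentiable (f : C^o -> C^o) (r%:C * w : C^o).
  exact/derivable1_diffP/(differentiable_comp dl df).
apply/derivable1_diffP; apply: fh; rewrite nmM nmC ger0_norm//.
have p : 0 < 1 + r by clear -r0; lra.
move: wr; rewrite ltr_pdivlMr//.
by have := nm_ge0 w; clear -r0 r1; nra.
Qed.

Let rad (k : nat) : R := 1 - harmonic k.

Let rad01 k : 0 <= rad k < 1.
Proof.
rewrite /rad /harmonic/= subr_ge0 gtrBl invr_gt0 ltr0n andbT.
by rewrite invf_le1 ?ler1n// ltr0n.
Qed.

Let rad_cvg : rad k @[k --> \oo] --> (1 : R).
Proof.
rewrite -[X in _ --> X]subr0; apply: cvgB; first exact: cvg_cst.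
exact: cvg_harmonic.
Qed.

Let rad_at_left : rad k @[k --> \oo] --> 1^'-.
Proof.
move=> P P1; have : \forall k \near \oo, rad k < 1 -> P (rad k) := rad_cvg P1.
by apply: filterS => k; apply; case/andP: (rad01 k).
Qed.

(** The Poisson representation passes from circles of radius r < 1 to the
    boundary, because an L2 bound excludes any loss of mass in the limit. *)
Theorem radial_poisson f (K : R) z : radial f -> L2_means K f -> nm z < 1 ->
  cintegrable (fun t => (poisson_kernel z t)%:C * f (cis t)) /\
  f z = cintegral (fun t => (poisson_kernel z t)%:C * f (cis t)).
Proof.
move=> [fh fm flim] fK z1.
pose fr k w := f ((rad k)%:C * w).
have hfr k : holomorphic (2 / (1 + rad k)) (fr k) by exact: holomorphic_scale.
have r1 k : 1 < 2 / (1 + rad k).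
  have /andP[r0 rk1] := rad01 k.
  have p : 0 < 1 + rad k by clear -r0; lra.
  by rewrite ltr_pdivlMr// mul1r; clear -rk1; lra.
pose B : R := ((1 - nm z) ^- 2) ^+ 2.
have B0 : 0 <= B by rewrite exprn_ge0// invr_ge0 exprn_ge0// subr_ge0 ltW.
have P0 t := poisson_kernel_ge0 t z1.
have PB t : poisson_kernel z t ^+ 2 <= B.
  rewrite ler_pXn2r// ?nnegrE ?invr_ge0 ?exprn_ge0 ?subr_ge0 ?(ltW z1)//.
  exact: poisson_kernel_le.
have mP : measurable_fun setT (poisson_kernel z : R -> R).
  by apply: measurable_fun_cont => t; exact: continuous_poisson_kernel.
have mT : (m setT < +oo)%E by rewrite circle_measureT ltry.
have key (L : C -> R) : (forall z w, L (z - w) = L z - L w) ->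
    (forall z, `|L z| <= nm z) ->
    measurable_fun setT (fun t : R => L (f (cis t))) ->
    [/\ m.-integrable setT (EFin \o (fun t => poisson_kernel z t * L (f (cis t)))) &
      \int[m]_t (poisson_kernel z t * L (fr k (cis t))) @[k --> \oo] -->
      \int[m]_t (poisson_kernel z t * L (f (cis t)))].
  move=> LB Ln mL.
  have cfr k : forall t : R, L (fr k (cis s)) @[s --> t] --> L (fr k (cis t)).
    by move=> t; apply: (cvgL LB Ln); exact: (holomorphic_ccontinuous (r1 k) (hfr k)).
  have mfr k : measurable_fun setT (fun t : R => L (fr k (cis t))).
    by apply: measurable_fun_cont => t; exact: cfr.
  have [||||] := @vitali_L2 _ _ _ m mT
    (fun k t => poisson_kernel z t * L (fr k (cis t)))
    (fun t => poisson_kernel z t * L (f (cis t))) (B * K).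
  - by move=> k; exact: (measurable_funM mP (mfr k)).
  - exact: (measurable_funM mP mL).
  - move=> k; apply: (@le_trans _ _ (\int[m]_t (B%:E * (nm (f ((rad k)%:C * cis t)) ^+ 2)%:E))%E).
      apply: ge0_le_integral => //.
      + by move=> t _; rewrite lee_fin sqr_ge0.
      + by apply/measurable_EFinP/measurable_funX; exact: (measurable_funM mP (mfr k)).
      + apply/measurable_EFinP; apply: measurable_funM => //.
        apply: measurable_fun_cont => t.
        exact: (@cvg_sqr_nm _ (nbhs t) _ (fun t => fr k (cis t)) _
          (@holomorphic_ccontinuous _ _ _ (r1 k) (hfr k) t)).
      + move=> t _; rewrite -EFinM lee_fin exprMn; apply: ler_pM => //.
          exact: sqr_ge0.
          exact: sqr_ge0.
        by rewrite -real_normK ?num_real// ler_pXn2r// ?nnegrE ?nm_ge0//; exact: Ln.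
    rewrite ge0_integralZl//.
    + by rewrite (EFinM B K); apply: lee_wpmul2l; [rewrite lee_fin|exact: fK].
    + apply/measurable_EFinP; apply: measurable_fun_cont => t.
      exact: (@cvg_sqr_nm _ (nbhs t) _ (fun t => fr k (cis t)) _
          (@holomorphic_ccontinuous _ _ _ (r1 k) (hfr k) t)).
    + by move=> t _; rewrite lee_fin sqr_ge0.
  - apply: filterS flim => t ft; apply: cvgM; first exact: cvg_cst.
    apply: (cvgL LB Ln).
    exact: (@cvg_comp _ _ _ rad (fun r => f (r%:C * cis t)) \oo 1^'- (nbhs (f (cis t) : C^o)) rad_at_left ft).
  - by move=> _ i1 c1; split.
have [iR cR] := key Re (@cReB R) (@Re_le_nm R) fm.1.
have [iI cI] := key Im (@cImB R) (@Im_le_nm R) fm.2.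
split.
  split.
    move: iR; congr (_.-integrable _ _).
    by apply/funext => t /=; rewrite ReCM.
  move: iI; congr (_.-integrable _ _).
  by apply/funext => t /=; rewrite ImCM.
have frz : fr k z @[k --> \oo] --> (f z : C^o).
  apply: cvgC_comp; first exact: fh.
  rewrite -[X in _ --> (X : C^o)]mul1r; apply: cvgCM; last exact: cvgC_cst.
  by rewrite -[1]/(1%:C); apply: cvg_realC; exact: rad_cvg.
have /cvgC_ReIm[zR zI] := frz.
have E k := poisson_formula (r1 k) (hfr k) z1.
have lim_eq (u : nat -> R) (a b : R) : u k @[k --> \oo] --> a ->
    u k @[k --> \oo] --> b -> a = b.
  by move=> ua ub; rewrite -(cvg_lim _ ua)// (cvg_lim _ ub).
apply: complexP; rewrite /cintegral /=.
  apply: (lim_eq _ _ _ zR).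
  under eq_Rintegral do rewrite ReCM.
  suff -> : (fun k => Re (fr k z)) =
      (fun k => \int[m]_t (poisson_kernel z t * Re (fr k (cis t)))) by [].
  apply/funext => k; rewrite E /cintegral /=.
  by apply: eq_Rintegral => t _; rewrite ReCM.
apply: (lim_eq _ _ _ zI).
under eq_Rintegral do rewrite ImCM.
suff -> : (fun k => Im (fr k z)) =
    (fun k => \int[m]_t (poisson_kernel z t * Im (fr k (cis t)))) by [].
apply/funext => k; rewrite E /cintegral /=.
by apply: eq_Rintegral => t _; rewrite ImCM.
Qed.

(** At the origin the Poisson kernel is constant. *)
Corollary radial_mean f (K : R) : radial f -> L2_means K f ->
  cintegrable (f \o @cis R) /\ f 0 = cintegral (f \o @cis R).
Proof.
move=> rf fK; have n0 : nm 0 < 1 by rewrite nm0.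
have := radial_poisson rf fK n0.
suff -> : (fun t => (poisson_kernel 0 t)%:C * f (cis t)) = f \o @cis R by [].
by apply/funext => t /=; rewrite poisson_kernel0 mul1r.
Qed.

(** Factor 2: the norm of a complex integral is estimated through its real and
    imaginary parts. *)
Corollary radial_bounded f (K M : R) : radial f -> L2_means K f -> 0 <= M ->
  {ae m, forall t : R, nm (f (cis t)) <= M} ->
  forall z, nm z < 1 -> nm (f z) <= 2 * M.
Proof.
move=> rf fK M0 fM z z1; have [[iR iI] ->] := radial_poisson rf fK z1.
have mP : measurable_fun setT (poisson_kernel z : R -> R).
  by apply: measurable_fun_cont => t; exact: continuous_poisson_kernel.
have iP : m.-integrable setT (EFin \o (poisson_kernel z : R -> R)).
  apply: circle_integrable => //; apply: integrable_cont => t _.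
  exact: continuous_poisson_kernel.
have iMP : m.-integrable setT (EFin \o (fun t : R => M * poisson_kernel z t)).
  exact: (integrableZl measurableT M iP).
have key (L : C -> R) : (forall z, `|L z| <= nm z) ->
    m.-integrable setT (EFin \o (L \o (fun t => (poisson_kernel z t)%:C * f (cis t)))) ->
    `|\int[m]_t L ((poisson_kernel z t)%:C * f (cis t))| <= M.
  move=> Ln iL; apply: le_trans (le_normr_Rintegral measurableT iL) _.
  have -> : M = \int[m]_t (M * poisson_kernel z t).
    by rewrite RintegralZl// integral_poisson_kernel// mulr1.
  have iN := integrable_norm iL.
  rewrite -lee_fin /Rintegral (fineK (integrable_fin_num measurableT iN)).
  rewrite (fineK (integrable_fin_num measurableT iMP)).
  apply: ae_ge0_le_integral => //.
  - by move=> t _; rewrite lee_fin normr_ge0.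
  - by move/integrableP: iN => [].
  - by move=> t _; rewrite lee_fin mulr_ge0// poisson_kernel_ge0.
  - by move/integrableP: iMP => [].
  - apply: filterS fM => t ft _; rewrite lee_fin.
    apply: le_trans (Ln _) _; rewrite nmM nmC ger0_norm ?poisson_kernel_ge0//.
    by rewrite mulrC ler_wpM2r// poisson_kernel_ge0.
apply: le_trans (nm_le_ReIm _) _; rewrite mulr_natl mulr2n /cintegral /=.
by apply: lerD; [exact: (key Re (@Re_le_nm R))|exact: (key Im (@Im_le_nm R))].
Qed.

End Radial.

(** * Integrals of functions that need not be measurable *)

Section AeLe.
Context d (T : measurableType d) (R : realType) (mu : {measure set T -> \bar R}).
Import HBNNSimple.
Local Open Scope ereal_scope.

(** The integral of a nonnegative function is a supremum over the simple functions
    below it, which needs no measurability; a simple function below f is below g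
    once it is set to 0 on the exceptional null set. This is how operator norms
    of matrix functions are compared, with no claim that they are measurable. *)
Lemma ae_le_integral (f g : T -> \bar R) : (forall x, 0 <= f x) ->
  (forall x, 0 <= g x) -> {ae mu, forall x, f x <= g x} ->
  \int[mu]_x f x <= \int[mu]_x g x.
Proof.
move=> f0 g0 [N [mN N0 sN]].
rewrite !ge0_integralTE//; apply: ge_ereal_sup => _ [h /= hf <-].
have mD : measurable (~` N) by exact: measurableC.
pose h' := proj_nnsfun h mD.
have h'E x : h' x = (h x * (x \in ~` N)%:R)%R by rewrite /h' /= mindicE.
have -> : sintegral mu h = sintegral mu h'.
  have hT (k : {nnsfun T >-> R}) : sintegral mu k = \int[mu]_x (k x)%:E.
    by rewrite integral_nnsfun// patch_setT.
  rewrite !hT.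
  apply: ge0_ae_eq_integral => //.
  - exact/measurable_EFinP.
  - exact/measurable_EFinP.
  - by move=> x _; rewrite lee_fin.
  - by move=> x _; rewrite lee_fin.
  exists N; split => // x nE; apply: contrapT => Nx; apply: nE => _.
  by rewrite h'E mem_set ?mulr1.
apply: le_ereal_sup_tmp; exists (sintegral mu h') => //; exists h' => // x.
rewrite h'E; case: (boolP (x \in ~` N)) => [|_]; last by rewrite mulr0.
rewrite inE mulr1 => Nx; apply: le_trans (hf x) _.
by apply: contrapT => fg; apply/Nx/sN.
Qed.

Lemma sqr_Lnorm2 (f : T -> R) :
  Lnorm mu 2%:E (EFin \o f) ^+ 2 = \int[mu]_x (f x ^+ 2)%:E.
Proof.
have L0 : 0 <= Lnorm mu 2%:E (EFin \o f) by exact: Lnorm_ge0.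
transitivity (Lnorm mu 2%:E (EFin \o f) `^ 2).
  case: (Lnorm mu 2%:E (EFin \o f)) L0 => [r|//|//].
    by rewrite lee_fin poweR_EFin => r0; rewrite powR_mulrn.
  by move=> _; rewrite poweRyr.
rewrite poweR_Lnorm//; apply: eq_integral => x _ /=.
by rewrite powR_mulrn// real_normK ?num_real.
Qed.

End AeLe.

(** * Outer functions *)

Section Outer.
Variable R : realType.
Local Notation C := R[i].
Local Notation nm := (@Normc.normc R).
Local Notation Re := (@complex.Re R).
Local Notation m := (@circle_measure R).

(** The kernel in the definition of outer functions has the Poisson kernel as its
    real part. *)
Lemma herglotz_Re (z : C) (t : R) : nm z < 1 ->
  Re ((cis t + z) / (cis t - z)) = poisson_kernel z t.
Proof.
move=> z1; have h := cis_subz_neq0 t z1; set w := cis t in h *.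
rewrite cinvE mulrCA.
rewrite ReCM mulrC /poisson_kernel -/w; congr (_ / _).
have w1 : nm w ^+ 2 = 1 by rewrite nm_cis expr1n.
rewrite -w1 !sqr_nm cconjB; case: (w) (z) => a b [c d] /=; ring.
Qed.

Lemma nm_cexp (z : C) : nm (cexp z) = expR (Re z).
Proof. by rewrite nmM nmC nm_cis mulr1 ger0_norm// expR_ge0. Qed.

Lemma in_L1_integrable (f : C -> R) : in_L 1%E f ->
  m.-integrable setT (EFin \o (fun t : R => f (cis t))).
Proof. by move=> /Lfun1_integrable. Qed.

Lemma integrable_poisson (l : R -> R) (z : C) : nm z < 1 ->
  m.-integrable setT (EFin \o l) ->
  m.-integrable setT (EFin \o (fun t => poisson_kernel z t * l t)).
Proof.
move=> z1 il; have ml : measurable_fun setT l.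
  by move/integrableP: il => [/measurable_EFinP].
have mP : measurable_fun setT (poisson_kernel z : R -> R).
  by apply: measurable_fun_cont => t; exact: continuous_poisson_kernel.
have B0 : 0 <= (1 - nm z) ^- 2 by rewrite invr_ge0 exprn_ge0// subr_ge0 ltW.
have := integrableZl measurableT ((1 - nm z) ^- 2) il.
apply: le_integrable => //.
  by apply/measurable_EFinP; exact: (measurable_funM mP ml).
move=> t _ /=; rewrite lee_fin (normrM (poisson_kernel z t)) (normrM (_ ^- 2)) ler_wpM2r//.
rewrite (ger0_norm B0) ger0_norm ?poisson_kernel_ge0//.
exact: poisson_kernel_le.
Qed.

Lemma nm_outer p (f : C -> C) (z : C) : outer p f -> nm z < 1 ->
  nm (f z) = expR (\int[m]_t (poisson_kernel z t * ln (nm (f (cis t))))).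
Proof.
move=> [_ _ _ [c c1 fE]] z1.
have -> : f z = _ := fE z _; last by rewrite normcC -(ltcR (nm z) 1) in z1 *.
rewrite nmM c1 mul1r nm_cexp /cintegral /=; congr expR.
by apply: eq_Rintegral => t _; rewrite mulrC ReCM herglotz_Re// mulrC.
Qed.

(** The logarithm of the modulus of an outer function is the Poisson integral of
    its boundary values, so that lower bounds spread to the disc. General
    analytic functions lack this property, because of their zeros and singular
    inner factors. *)
Lemma outer_lower p (f : C -> C) (a : R) : outer p f ->
  {ae m, forall t : R, - a <= ln (nm (f (cis t)))} ->
  forall z, nm z < 1 -> expR (- a) <= nm (f z).
Proof.
move=> fo fa z z1; rewrite (nm_outer fo z1) ler_expR.
have [_ _ /in_L1_integrable il _] := fo.
have iP := integrable_poisson z1 il.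
have mP : measurable_fun setT (poisson_kernel z : R -> R).
  by apply: measurable_fun_cont => t; exact: continuous_poisson_kernel.
have iP1 : m.-integrable setT (EFin \o (poisson_kernel z : R -> R)).
  apply: circle_integrable => //; apply: integrable_cont => t _.
  exact: continuous_poisson_kernel.
have iPa : m.-integrable setT (EFin \o (fun t => - a * poisson_kernel z t)).
  exact: (integrableZl measurableT (- a) iP1).
have -> : - a = \int[m]_t (- a * poisson_kernel z t).
  by rewrite RintegralZl// integral_poisson_kernel// mulr1.
rewrite -subr_ge0 -RintegralB//.
rewrite /Rintegral fine_ge0//.
have -> : (\int[m]_t (poisson_kernel z t * ln (nm (f (cis t))) - - a * poisson_kernel z t)%:E =
   \int[m]_t (`|poisson_kernel z t * ln (nm (f (cis t))) - - a * poisson_kernel z t|)%:E)%E.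
  have iD := integrableB measurableT iP iPa.
  have mD : measurable_fun setT
      (fun t => poisson_kernel z t * ln (nm (f (cis t))) - - a * poisson_kernel z t).
    by move/integrableP: iD => [/measurable_EFinP].
  apply: ae_eq_integral => //.
  - exact/measurable_EFinP.
  - by apply/measurable_EFinP; exact: measurableT_comp.
  apply: filterS fa => t at_ _ /=; congr EFin; rewrite ger0_norm//.
  by rewrite mulrC -mulrBl mulr_ge0 ?poisson_kernel_ge0// subr_ge0.
by apply: integral_ge0 => t _; rewrite lee_fin.
Qed.

Lemma nm_outer0 p (f : C -> C) : outer p f ->
  nm (f 0) = expR (\int[m]_t ln (nm (f (cis t)))).
Proof.
move=> fo; have n0 : nm 0 < 1 by rewrite nm0.
rewrite (nm_outer fo n0); congr expR; apply: eq_Rintegral => t _.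
by rewrite poisson_kernel0 mul1r.
Qed.

Lemma Lnorm_infty_bound (f : R -> R) : (Lnorm m +oo (EFin \o f) < +oo)%E ->
  exists2 M, Lnorm m +oo (EFin \o f) = M%:E & {ae m, forall t, `|f t| <= M}.
Proof.
move=> fy; have f0 : (0 <= Lnorm m +oo (EFin \o f))%E by exact: Lnorm_ge0.
have ff : Lnorm m +oo (EFin \o f) \is a fin_num by rewrite ge0_fin_numE.
exists (fine (Lnorm m +oo (EFin \o f))); first by rewrite fineK.
have E : Lnorm m +oo (EFin \o f) = ess_sup m (abse \o (EFin \o f)).
  by rewrite unlock circle_measureT lte01.
apply: filterS (ess_sup_ge m (abse \o (EFin \o f))) => t.
by rewrite -E -lee_fin fineK.
Qed.

End Outer.

(** * The quotient of two analytic matrix functions *)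

Section Quotient.
Variable R : realType.
Local Notation C := R[i].
Local Notation nm := (@Normc.normc R).
Local Notation m := (@circle_measure R).

Lemma measurable_sqr_nm_scale (f : C -> C) (r : R) : holomorphic 1 f -> 0 <= r < 1 ->
  measurable_fun setT (fun t : R => nm (f (r%:C * cis t)) ^+ 2).
Proof.
move=> fh r01; have hf := holomorphic_scale fh r01.
have r1 : 1 < 2 / (1 + r).
  have /andP[r0 rk1] := r01; have p : 0 < 1 + r by clear -r0; lra.
  by rewrite ltr_pdivlMr// mul1r; clear -rk1; lra.
apply: measurable_fun_cont => t.
exact: (@cvg_sqr_nm _ _ (nbhs t) _ (fun t => f (r%:C * cis t)) _
  (@holomorphic_ccontinuous _ _ _ r1 hf t)).
Qed.

(** S^{-1} T, written with the adjugate so that its entries are visibly polynomials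
    in the entries of S and T, divided by det S. *)
Definition quotmx n (S T : 'M[C]_n) : 'M[C]_n := (\det S)^-1 *: (\adj S *m T).

Lemma quotmxE n (S T : 'M[C]_n) : S \in unitmx -> quotmx S T = invmx S *m T.
Proof. by move=> Su; rewrite /quotmx /invmx Su scalemxAl. Qed.

Lemma radial_tr_quotmx n (S T : C -> 'M[C]_n) :
  (forall i j, radial (fun z => S z i j)) ->
  (forall i j, radial (fun z => T z i j)) ->
  (forall z, nm z < 1 -> \det (S z) != 0) ->
  {ae m, forall t : R, \det (S (cis t)) != 0} ->
  radial (fun z => \tr (quotmx (S z) (T z))).
Proof.
move=> rS rT S0 Sb.
have -> : (fun z => \tr (quotmx (S z) (T z))) = (fun z => (\det (S z))^-1 *
    \sum_(i < n) \sum_(k < n) (\adj (S z)) i k * T z k i).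
  apply/funext => z; rewrite mxtraceZ; congr (_ * _).
  by apply: eq_bigr => i _; rewrite mxE.
apply: radialM; first by apply: radialV => //; exact: radial_det.
apply: radial_sum => i; apply: radial_sum => k.
by apply: radialM; [exact: radial_adj|exact: rT].
Qed.

Lemma frob2_adjugate_le n (M : 'M[C]_n) (b : R) : (forall i j, nm (M i j) <= b) ->
  frob2 (\adj M) <= (n ^ 2)%:R * ((n.-1)`!%:R * b ^+ n.-1) ^+ 2.
Proof.
move=> Mb; set c := _ * b ^+ _.
have -> : (n ^ 2)%:R * c ^+ 2 = \sum_(i < n) \sum_(j < n) c ^+ 2.
  by rewrite !sumr_const card_ord -mulrnA mulr_natl.
apply: ler_sum => i _; apply: ler_sum => j _.
have := nm_adj_le i j Mb; rewrite -/c => h.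
by rewrite lerXn2r ?nnegrE ?nm_ge0// (le_trans _ h)// nm_ge0.
Qed.

(** The adjugate of a bounded S is bounded and det S stays away from 0, hence the
    trace of the quotient is dominated by the entries of T. *)
Lemma L2_means_tr_quotmx n (S T : C -> 'M[C]_n) (b e : R) (K : 'I_n -> 'I_n -> R) :
  (forall i j, radial (fun z => T z i j)) ->
  (forall i j, L2_means (K i j) (fun z => T z i j)) ->
  (forall z, nm z < 1 -> forall i j, nm (S z i j) <= b) -> 0 < e ->
  (forall z, nm z < 1 -> e <= nm (\det (S z))) ->
  exists K', L2_means K' (fun z => \tr (quotmx (S z) (T z))).
Proof.
move=> rT TK Sb e0 Se.
pose c : R := n%:R * (e ^- 2 * ((n ^ 2)%:R * ((n.-1)`!%:R * b ^+ n.-1) ^+ 2)).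
have c0 : 0 <= c.
  have e2 : 0 <= e ^- 2 by rewrite invr_ge0 exprn_ge0// ltW.
  exact: (mulr_ge0 (ler0n _ _) (mulr_ge0 e2 (mulr_ge0 (ler0n _ _) (sqr_ge0 _)))).
exists (c * \sum_i \sum_j K i j) => r r01.
have [r0 r1] := andP r01.
have ptw t : nm (\tr (quotmx (S (r%:C * cis t)) (T (r%:C * cis t)))) ^+ 2 <=
    c * \sum_i \sum_j nm (T (r%:C * cis t) i j) ^+ 2.
  have z1 : nm (r%:C * cis t) < 1 by rewrite nmM nm_cis mulr1 nmC ger0_norm.
  move: (Sb _ z1) (Se _ z1); move: (_ * cis t) => z {}Sb {}Se.
  apply: le_trans (sqr_nm_trace _) _; rewrite -mulrA ler_wpM2l// frob2Z.
  rewrite -[leRHS]mulrA; apply: ler_pM; [exact: sqr_ge0|exact: frob2_ge0| |].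
    rewrite nmV exprVn lef_pV2 ?posrE ?exprn_gt0//; last exact: lt_le_trans Se.
    by rewrite lerXn2r ?nnegrE ?nm_ge0 ?(ltW e0).
  apply: le_trans (frob2M _ _) _; rewrite ler_wpM2r ?frob2_ge0//.
  exact: frob2_adjugate_le.
have mT i j : measurable_fun setT (fun t : R => nm (T (r%:C * cis t) i j) ^+ 2).
  by apply: (measurable_sqr_nm_scale (f := fun z => T z i j)) => //; case: (rT i j).
apply: (@le_trans _ _
  (\int[m]_t (c%:E * \sum_i \sum_j (nm (T (r%:C * cis t)%R i j) ^+ 2)%:E))%E).
  apply: ae_le_integral.
  - by move=> t; rewrite lee_fin sqr_ge0.
  - move=> t; rewrite mule_ge0// ?lee_fin//.
    by apply: sume_ge0 => i _; apply: sume_ge0 => j _; rewrite lee_fin sqr_ge0.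
  - apply: aeW => t; under eq_bigr do rewrite sumEFin.
    by rewrite sumEFin -EFinM lee_fin.
have mE i j : measurable_fun setT (fun t : R => (nm (T (r%:C * cis t) i j) ^+ 2)%:E).
  by apply/measurable_EFinP; exact: mT.
have ms i : measurable_fun setT
    (fun t : R => (\sum_(j < n) (nm (T (r%:C * cis t)%R i j) ^+ 2)%:E)%E).
  by apply: emeasurable_sum => j _; exact: mE.
have s0 i t : (0 <= \sum_(j < n) (nm (T (r%:C * cis t)%R i j) ^+ 2)%:E)%E.
  by apply: sume_ge0 => j _; rewrite lee_fin sqr_ge0.
rewrite ge0_integralZl//.
- rewrite (EFinM c) lee_wpmul2l ?lee_fin//.
  rewrite (ge0_integral_sum m measurableT ms (fun i t _ => s0 i t)).
  rewrite -sumEFin; apply: lee_sum => i _.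
  have e0' j (t : R) : setT t -> (0 <= (nm (T (r%:C * cis t) i j) ^+ 2)%:E)%E.
    by move=> _; rewrite lee_fin sqr_ge0.
  rewrite (ge0_integral_sum m measurableT (mE i) e0').
  by rewrite -sumEFin; apply: lee_sum => j _; exact: TK.
- by apply: emeasurable_sum.
- by move=> t _; apply: sume_ge0.
Qed.

End Quotient.

(** * Spectral factors *)

Section Factor.
Variable R : realType.
Local Notation C := R[i].
Local Notation nm := (@Normc.normc R).
Local Notation Re := (@complex.Re R).
Local Notation m := (@circle_measure R).

Lemma posdef_logdet n (A : 'M[C]_n) : posdefmx A -> logdet A = ln (nm (\det A)).
Proof.
by move=> pA; have [d0 dE] := posdef_det pA; rewrite dE nmC gtr0_norm// /logdet dE.
Qed.

Lemma logdet_factor n (A S : 'M[C]_n) : posdefmx A -> A = S *m S^t* ->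
  \det S != 0 /\ logdet A = 2 * ln (nm (\det S)).
Proof.
move=> pA AS; have := posdef_unit pA; rewrite AS unitmx_mul => /andP[Su _].
have S0 : \det S != 0 by rewrite -unitfE -unitmxE.
split=> //; rewrite -AS (posdef_logdet pA) AS det_mulmx det_map_mx det_tr.
by rewrite nmM nm_conj lnM ?posrE ?nm_gt0// mulr_natl mulr2n.
Qed.

Section OneFactor.
Variables (n : nat) (F Fp : C -> 'M[C]_n).
Hypotheses (dF : spectral_density F) (fF : spectral_factor F Fp).

Lemma factor_ae : {ae m, forall t : R,
  [/\ posdefmx (F (cis t)), F (cis t) = Fp (cis t) *m (Fp (cis t)) ^t*,
      \det (Fp (cis t)) != 0 &
      logdet (F (cis t)) = 2 * ln (nm (\det (Fp (cis t))))]}.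
Proof.
have [_ pF _] := dF; have [_ FE _] := fF.
by apply: filterS2 pF FE => t pF FE; have [] := logdet_factor pF FE.
Qed.

Lemma factor_radial i j : radial (fun z => Fp z i j).
Proof. by have [[h _] _ _] := fF; have [] := hardy2_L2_means (h i j). Qed.

Lemma factor_L2_means :
  exists K : 'I_n -> 'I_n -> R, forall i j, L2_means (K i j) (fun z => Fp z i j).
Proof.
have [[h _] _ _] := fF.
have /choice[K KP] : forall ij : 'I_n * 'I_n,
    exists k, L2_means k (fun z => Fp z ij.1 ij.2).
  by move=> ij; have [] := hardy2_L2_means (h ij.1 ij.2).
by exists (fun i j => K (i, j)) => i j; exact: (KP (i, j)).
Qed.

(** On the circle, the squares of the entries are at most n |F|. This bound enters
    the disc by the Poisson formula. *)
Lemma factor_bounded (M : R) : {ae m, forall t : R, opnorm (F (cis t)) <= M} ->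
  exists b, forall z, nm z < 1 -> forall i j, nm (Fp z i j) <= b.
Proof.
move=> FM; exists (2 * Num.sqrt (M * n%:R)) => z z1 i j.
have [K KP] := factor_L2_means.
apply: (radial_bounded (factor_radial i j) (KP i j) (sqrtr_ge0 _)) => //.
apply: filterS2 FM factor_ae => t FM [_ FE _ _].
rewrite -(ler_pXn2r (_ : (0 < 2)%N))// ?nnegrE ?nm_ge0 ?sqrtr_ge0//.
have f1 : frob2 (1%:M : 'M[C]_n) = n%:R.
  rewrite -[LHS]/(Re (frob2 (1%:M : 'M[C]_n))%:C) -frob2_tr.
  by rewrite trmx1 map_mx1 mulmx1 mxtrace1 Re_nat.
have h : nm (Fp (cis t) i j) ^+ 2 <= M * n%:R.
  apply: le_trans (sqr_nm_entry _ _ _) _.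
  rewrite -[Fp (cis t)]mulmx1; apply: le_trans (frob2_factor _ _) _.
  by rewrite -FE f1 ler_wpM2r.
by rewrite sqr_sqrtr// (le_trans _ h)// sqr_ge0.
Qed.

Lemma integrable_logdet : m.-integrable setT (EFin \o (fun t : R => logdet (F (cis t)))).
Proof. by have [_ _] := dF => /in_L1_integrable. Qed.

(** The outer function det F_+ has modulus exp of the mean of its boundary values
    at the origin, and 2 ln |det F_+| = ln det F on the circle. *)
Lemma logdet_factor0 :
  2 * logdet (Fp 0) = \int[m]_t logdet (F (cis t)).
Proof.
have [[_ od] _ p0] := fF; rewrite posdef_logdet// (nm_outer0 od) expRK.
have [_ _ /in_L1_integrable il _] := od.
rewrite -RintegralZl//; congr fine; apply: ae_eq_integral => //.
- apply/measurable_EFinP; apply: measurable_funM => //.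
  by move/integrableP: il => [/measurable_EFinP].
- by move/integrableP: integrable_logdet => [].
by apply: filterS factor_ae => t [_ _ _ ->] _.
Qed.

Lemma factor_det_lower (L : R) :
  {ae m, forall t : R, - L <= logdet (F (cis t))} ->
  forall z, nm z < 1 -> expR (- (L / 2)) <= nm (\det (Fp z)).
Proof.
move=> hL; have [[_ od] _ _] := fF; apply: (outer_lower od).
apply: filterS2 hL factor_ae => t hL [_ _ _ E].
by move: hL; rewrite E; clear; lra.
Qed.

End OneFactor.

(** The trace of F_+^{-1} G_+ has the mean value property. At the origin, where
    both factors are positive definite, its real part is bounded from below by
    the arithmetic-geometric mean inequality, and the determinants there are
    known because they are outer. *)
Lemma trace_quot_mean n (F G Fp Gp : C -> 'M[C]_n) (M L : R) :
  spectral_density F -> spectral_density G ->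
  spectral_factor F Fp -> spectral_factor G Gp ->
  {ae m, forall t : R, opnorm (F (cis t)) <= M} ->
  {ae m, forall t : R, - L <= logdet (F (cis t))} ->
  let h t := Re (\tr (quotmx (Fp (cis t)) (Gp (cis t)))) in
  m.-integrable setT (EFin \o h) /\
  n%:R + (\int[m]_t (logdet (G (cis t)) - logdet (F (cis t)))) / 2 <= \int[m]_t h t.
Proof.
move=> dF dG fF fG FM FL h.
have [b Fb] := factor_bounded dF fF FM.
have Fe := factor_det_lower dF fF FL.
have [K GK] := factor_L2_means fG.
have F0 z : nm z < 1 -> \det (Fp z) != 0.
  by move=> z1; rewrite -nm_gt0 (lt_le_trans _ (Fe z z1))// expR_gt0.
have [K' hK] := L2_means_tr_quotmx (factor_radial fG) GK Fb (expR_gt0 _) Fe.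
have Fb0 : {ae m, forall t : R, \det (Fp (cis t)) != 0}.
  by apply: filterS (factor_ae dF fF) => t [].
have rh := radial_tr_quotmx (factor_radial fF) (factor_radial fG) F0 Fb0.
have [[ih _] h0] := radial_mean rh hK.
split=> //.
have -> : \int[m]_t h t = Re (\tr (quotmx (Fp 0) (Gp 0))) by rewrite h0.
have [_ _ pF] := fF; have [_ _ pG] := fG.
rewrite quotmxE ?posdef_unit//; apply: le_trans (trace_ge_logdet pF pG).
rewrite RintegralB//; [|exact: integrable_logdet dG|exact: integrable_logdet dF].
by rewrite -(logdet_factor0 dF fF) -(logdet_factor0 dG fG); clear; lra.
Qed.

End Factor.

(** * The estimate *)

Section Combination.
Context d (T : measurableType d) (R : realType) (mu : {measure set T -> \bar R}).

(** Only the lower bound V of c g, the function q and their sum are integrated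
    termwise; a and g enter through comparisons alone and may fail to be
    measurable. An infinite integral of g makes the right-hand side infinite,
    unless M = 0, when a vanishes almost everywhere. *)
Lemma integral_combination (a g V q : T -> R) (c M K : R) :
  (forall t, 0 <= g t) -> (forall t, 0 <= V t) -> measurable_fun setT V ->
  mu.-integrable setT (EFin \o q) -> \int[mu]_t q t <= K -> 0 <= M -> 0 < c ->
  {ae mu, forall t, V t <= c * g t} ->
  {ae mu, forall t, 0 <= V t + q t} ->
  {ae mu, forall t, a t ^+ 2 <= M * (V t + q t)} ->
  (\int[mu]_t (a t ^+ 2)%:E <=
   M%:E * (c%:E * \int[mu]_t (g t)%:E + K%:E))%E.
Proof.
move=> g0 V0 mV iq qK M0 c0 Vg Vq aM.
have sq0 t : (0 <= (a t ^+ 2)%:E)%E by rewrite lee_fin sqr_ge0.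
have [M_eq0|M_neq0] := eqVneq M 0.
  rewrite M_eq0 mul0e -(@integral0 _ _ _ mu setT); apply: ae_le_integral => //.
  by apply: filterS aM => t; rewrite M_eq0 mul0r lee_fin.
have Mp : 0 < M by rewrite lt0r M_neq0.
have gV : (\int[mu]_t (V t)%:E <= c%:E * \int[mu]_t (g t)%:E)%E.
  have -> : (\int[mu]_t (V t)%:E = c%:E * \int[mu]_t (V t / c)%:E)%E.
    rewrite -ge0_integralZl//.
    - by apply: eq_integral => t _; rewrite -EFinM mulrC divfK// gt_eqF.
    - by apply/measurable_EFinP; apply: measurable_funM.
    - by move=> t _; rewrite lee_fin divr_ge0// ltW.
    - by rewrite lee_fin ltW.
  apply: lee_wpmul2l; first by rewrite lee_fin ltW.
  apply: ae_le_integral.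
  - by move=> t; rewrite lee_fin divr_ge0// ltW.
  - by move=> t; rewrite lee_fin.
  - by apply: filterS Vg => t h; rewrite lee_fin ler_pdivrMr// mulrC.
have [gy|gy] := eqVneq (\int[mu]_t (g t)%:E)%E +oo%E.
  by rewrite gy gt0_muley ?lte_fin// addye// gt0_muley ?lte_fin// leey.
have gf : (\int[mu]_t (g t)%:E)%E \is a fin_num.
  rewrite ge0_fin_numE; last by apply: integral_ge0 => t _; rewrite lee_fin.
  by rewrite ltey.
have iV : mu.-integrable setT (EFin \o V).
  apply/integrableP; split; first exact/measurable_EFinP.
  apply: le_lt_trans (_ : c%:E * \int[mu]_t (g t)%:E < +oo)%E.
    apply: le_trans gV; rewrite le_eqVlt; apply/orP; left; apply/eqP.
    by apply: eq_integral => t _ /=; rewrite ger0_norm.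
  by rewrite ltey_eq fin_numM.
have iVq := integrableD measurableT iV iq.
have mq : measurable_fun setT q by move/integrableP: iq => [/measurable_EFinP].
apply: (@le_trans _ _ (\int[mu]_t (M%:E * `|(V t + q t)%:E|))%E).
  apply: ae_le_integral => //; first by move=> t; rewrite mule_ge0// lee_fin.
  apply: filterS2 aM Vq => t aM Vq.
  by rewrite abse_EFin ger0_norm// -EFinM lee_fin.
have mVq : measurable_fun setT (fun t => (V t + q t)%:E).
  by apply/measurable_EFinP; exact: measurable_funD.
rewrite ge0_integralZl//; last exact: measurableT_comp.
apply: lee_wpmul2l; first by rewrite lee_fin.
have -> : (\int[mu]_t `|(V t + q t)%:E| = \int[mu]_t ((V t)%:E + (q t)%:E))%E.
  apply: ae_eq_integral => //; first exact: measurableT_comp.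
  by apply: filterS Vq => t Vq _; rewrite abse_EFin ger0_norm.
rewrite integralD//; apply: leeD => //.
by rewrite -(fineK (integrable_fin_num measurableT iq)) lee_fin.
Qed.

End Combination.

Section Pointwise.
Variable R : realType.
Local Notation C := R[i].
Local Notation Re := (@complex.Re R).
Local Notation m := (@circle_measure R).

Lemma measurable_frob2_quotmx n (S T : C -> 'M[C]_n) :
  (forall i j, radial (fun z => S z i j)) ->
  (forall i j, radial (fun z => T z i j)) ->
  measurable_fun setT (fun t : R => frob2 (quotmx (S (cis t)) (T (cis t)))).
Proof.
move=> rS rT; apply: measurable_sum => i; apply: measurable_sum => j.
apply: (@measurable_circle_sqr_nm _ (fun z => quotmx (S z) (T z) i j)).
have -> : (fun z => quotmx (S z) (T z) i j) = (fun z => (\det (S z))^-1 *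
    \sum_(k < n) (\adj (S z)) i k * T z k j).
  by apply/funext => z; rewrite !mxE.
apply: measurable_circleM.
  by apply: measurable_circleV; case: (radial_det rS).
suff [] : radial (fun z => \sum_(k < n) (\adj (S z)) i k * T z k j) by [].
by apply: radial_sum => k; apply: radialM; [exact: radial_adj|exact: rT].
Qed.

Lemma frob2_quotmx_le n (A B S T : 'M[C]_n) (L : R) : posdefmx A ->
  A = S *m S^t* -> B = T *m T^t* ->
  n%:R * logplus (opnorm A) - logdet A <= L ->
  frob2 (quotmx S T) - n%:R <= n%:R * expR L * opnorm (B - A).
Proof.
move=> pA AS BT AL.
have [S0 _] := logdet_factor pA AS.
have Su : S \in unitmx by rewrite unitmxE unitfE.
rewrite quotmxE//; apply: le_trans (frob2_quotient_le T Su) _.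
rewrite -AS -BT mulrC ler_wpM2r ?opnorm_ge0//.
apply: le_trans (frob2_inv_factor pA AS) _.
by rewrite ler_wpM2l// ler_expR.
Qed.

Lemma sqr_opnorm_quotmx_le n (A S T : 'M[C]_n) (M : R) : posdefmx A ->
  A = S *m S^t* -> opnorm A <= M ->
  opnorm (T - S) ^+ 2 <=
  M * (frob2 (quotmx S T) - n%:R + (2 * n%:R - 2 * Re (\tr (quotmx S T)))).
Proof.
move=> pA AS AM; have [S0 _] := logdet_factor pA AS.
have Su : S \in unitmx by rewrite unitmxE unitfE.
apply: le_trans (sqr_opnorm_sub_le T Su) _; rewrite -AS -quotmxE//.
have -> : frob2 (quotmx S T) - n%:R + (2 * n%:R - 2 * Re (\tr (quotmx S T))) =
  frob2 (quotmx S T - 1%:M) by rewrite frob2_sub1; clear; lra.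
by rewrite ler_wpM2r ?frob2_ge0.
Qed.

End Pointwise.

Local Open Scope ereal_scope.

Theorem theorem1p5 (R : realType) (n : nat) (n_gt0 : (0 < n)%N)
    (F G Fp Gp : R[i] -> 'M[R[i]]_n)
    (F_density : spectral_density F)
    (F_bounded : in_Lmx +oo F)
    (ellF_bounded : in_L +oo (ell F))
    (G_density : spectral_density G)
    (Fp_factor : spectral_factor F Fp)
    (Gp_factor : spectral_factor G Gp) :
  H2norm (fun z => Gp z - Fp z)%R ^+ 2 <=
  Lnorm_mx +oo F *
    (n%:R%:E * expeR (Lnorm_fun +oo (ell F))
       * Lnorm_mx 1 (fun z => G z - F z)%R
     + Lnorm_fun 1 (fun z => ln (complex.Re (\det (G z) / \det (F z))))%R).
Proof.
pose m := @circle_measure R.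
have [M ME FM] := Lnorm_infty_bound F_bounded.2.
have ell_fin : Lnorm_fun +oo (ell F) < +oo.
  by move: ellF_bounded; rewrite /in_L => /sub_Lfun_finLfun; rewrite inE.
have [L LE FL] := Lnorm_infty_bound ell_fin.
have M0 : (0 <= M)%R by rewrite -lee_fin -ME; exact: Lnorm_ge0.
have FM' : {ae m, forall t : R, (opnorm (F (cis t)) <= M)%R}.
  by apply: filterS FM => t; rewrite ger0_norm// opnorm_ge0.
have FL' : {ae m, forall t : R, (- L <= logdet (F (cis t)))%R}.
  apply: filterS FL => t; rewrite ler_norml => /andP[+ _] => /le_trans; apply.
  rewrite /ell lerBlDr lerDl mulr_ge0//.
  by rewrite /logplus le_max lexx.
have [ih hmean] := trace_quot_mean F_density G_density Fp_factor Gp_factor FM' FL'.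
set X := fun t : R => quotmx (Fp (cis t)) (Gp (cis t)).
have {}ih : m.-integrable setT (EFin \o (fun t => complex.Re (\tr (X t)))) := ih.
pose l t : R := ln (complex.Re (\det (G (cis t)) / \det (F (cis t))))%R.
have Ll : Lnorm_fun 1 (fun z => ln (complex.Re (\det (G z) / \det (F z))))%R =
  \int[m]_t `|l t|%:E by rewrite /Lnorm_fun Lnorm1.
have Lg : Lnorm_mx 1 (fun z => G z - F z)%R =
    \int[m]_t (opnorm (G (cis t) - F (cis t)))%:E.
  rewrite /Lnorm_mx /Lnorm_fun Lnorm1; apply: eq_integral => t _ /=.
  by rewrite ger0_norm// opnorm_ge0.
have LE' : Lnorm_fun +oo (ell F) = L%:E := LE.
have ME' : Lnorm_mx +oo F = M%:E := ME.
rewrite /H2norm LE' ME' Lg Ll /Lnorm_mx /Lnorm_fun sqr_Lnorm2 /= -EFinM.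
have iGF : m.-integrable setT
    (EFin \o (fun t : R => logdet (G (cis t)) - logdet (F (cis t)))%R).
  by have := integrableB measurableT (integrable_logdet G_density)
    (integrable_logdet F_density).
pose K : R := (\int[m]_t `|logdet (G (cis t)) - logdet (F (cis t))|)%R.
have Kl : K%:E <= \int[m]_t `|l t|%:E.
  have -> : K%:E = \int[m]_t `|logdet (G (cis t)) - logdet (F (cis t))|%:E.
    by rewrite /K /Rintegral fineK// (integrable_fin_num measurableT (integrable_norm iGF)).
  apply: ae_le_integral => //.
  apply: filterS2 (factor_ae F_density Fp_factor) (factor_ae G_density Gp_factor).
  move=> t [pF _ _ _] [pG _ _ _]; rewrite lee_fin /l /logdet.
  have [F0 FE] := posdef_det pF; have [G0 GE] := posdef_det pG.
  by rewrite FE GE -fmorph_div/= ln_div ?posrE.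
apply: (@le_trans _ _ (M%:E * ((n%:R * expR L)%:E *
    (\int[m]_t (opnorm (G (cis t) - F (cis t)))%:E) + K%:E))); last first.
  by rewrite lee_wpmul2l ?lee_fin// leeD2l.
(* |G_+ - F_+|^2 is at most M |X - 1|^2 in the Hilbert-Schmidt norm, and
   |X - 1|^2 = (|X|^2 - n) + (2 n - 2 Re tr X). The first term, whose positive
   part is V, is controlled by |G - F|, the second by the mean value of tr X. *)
pose V t : R := Num.max 0%R (frob2 (X t) - n%:R)%R.
have iq : m.-integrable setT
    (EFin \o (fun t => 2 * n%:R - 2 * complex.Re (\tr (X t)))%R).
  have i1 : m.-integrable setT (EFin \o (fun _ : R => (2 * n%:R)%R : R)).
    by apply: circle_integrable => //; apply: integrable_cont => t _; exact: cst_continuous.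
  exact: (integrableB measurableT i1 (integrableZl measurableT 2%R ih)).
apply: (@integral_combination _ _ _ m _ _ V
  (fun t => 2 * n%:R - 2 * complex.Re (\tr (X t)))%R).
- by move=> t; exact: opnorm_ge0.
- by move=> t; rewrite /V le_max lexx.
- apply: measurable_maxr => //; apply: measurable_funB => //.
  exact: (measurable_frob2_quotmx (factor_radial Fp_factor) (factor_radial Gp_factor)).
- exact: iq.
- have i1 : m.-integrable setT (EFin \o (fun _ : R => (2 * n%:R)%R : R)).
    by apply: circle_integrable => //; apply: integrable_cont => t _; exact: cst_continuous.
  have i2 : m.-integrable setT (EFin \o (fun t => 2 * complex.Re (\tr (X t)))%R).
    exact: (integrableZl measurableT 2%R ih).
  rewrite (RintegralB measurableT i1 i2).
  have -> : (\int[m]_t (2 * complex.Re (\tr (X t))) =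
      2 * \int[m]_t complex.Re (\tr (X t)))%R by rewrite RintegralZl.
  have -> : (\int[m]_t (2 * n%:R) = 2 * n%:R :> R)%R.
    by rewrite /Rintegral integral_cst// circle_measureT mule1.
  have := le_normr_Rintegral measurableT iGF; rewrite -/K => hK.
  have hK' : (- K <= \int[m]_t (logdet (G (cis t)) - logdet (F (cis t))))%R.
    by rewrite lerNl (le_trans _ hK)// -normrN ler_norm.
  by move: hmean hK'; rewrite -/m -/X; clear; lra.
- exact: M0.
- by rewrite mulr_gt0 ?expR_gt0 ?ltr0n.
- apply: filterS3 (factor_ae F_density Fp_factor) (factor_ae G_density Gp_factor) FL.
  move=> t [pF FE _ _] [pG GE _ _]; rewrite ler_norml => /andP[FL _].
  rewrite /V ge_max mulr_ge0 ?opnorm_ge0 ?mulr_ge0 ?expR_ge0//=.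
  apply: (frob2_quotmx_le pF FE GE).
  by move: FL; rewrite /ell; clear; lra.
- apply: filterS (factor_ae F_density Fp_factor) => t [pF FE _ _].
  apply: (@le_trans _ _ (frob2 (X t - 1%:M))); first exact: frob2_ge0.
  have : (frob2 (X t) - n%:R <= V t)%R by rewrite /V le_max lexx orbT.
  by rewrite frob2_sub1; clear; lra.
- apply: filterS2 (factor_ae F_density Fp_factor) FM' => t [pF FE _ _] FM1.
  apply: le_trans (sqr_opnorm_quotmx_le _ pF FE FM1) _.
  by rewrite ler_wpM2l// lerD2r /V le_max lexx orbT.
Qed.
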